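(* Let $\sigma$ be an irreducible signature. Then $\sigma$ is extendable if and only if the following two conditions hold. (1) There exists $\omega\in W_{(ab,cd)}$ such that $T^\omega_3$ is the tableau associated to a system of paths (of size $3$, labeled by $[3]$) with signature $\sigma$. (2) $\sigma=\alpha\cdot\beta\cdot\gamma$ or $\sigma=\gamma\cdot\beta\cdot\alpha$ for some words $\alpha,\beta,\gamma$ such that $$\begin{pmatrix} X(\alpha)&Y(\alpha)&Z(\alpha)\\ X(\beta)&Y(\beta)&Z(\beta)\\ X(\gamma)&Y(\gamma)&Z(\gamma)\end{pmatrix}=\begin{pmatrix} p&p&0\\ q&0&p\\ 0&q&q\end{pmatrix}$$ where $p$ and $q$ are non-negative integers not both equal to $0$. Furthermore, if $S$ is a regular system labeled by $[n]$ with irreducible signature $\sigma$ and $\omega\in W_{(ab,cd)}$ is the word satisfying condition (1), then $T^\omega_n$ is the tableau associated to $S$.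
   Context: Systems. A path is the graph of a continuous function $f:[0,1]\to\mathbb{R}$. A system of paths is a finite collection of at least three paths such that: the left endpoints are pairwise distinct and the right endpoints are pairwise distinct; any two paths intersect in finitely many points; paths cross at every point where they intersect; no three paths have a common point. The size is the number of paths; a subsystem is a subset of at least three paths. A system of size $n$ is labeled by $[n]=\{1,\dots,n\}$ in the order of left endpoints from bottom to top. The local sequence of path $i$ is the sequence on $[n]\setminus\{i\}$ recording the order in which path $i$ meets the other paths from left to right. The tableau associated to the system is the $n$-tuple whose $i$-th entry is the local sequence of path $i$. Signatures. For a system of size $3$ with paths labeled $i_1<i_2<i_3$ (in order of left endpoints from bottom to top), the signature is the word on $\{x,y,z\}$ listing the crossings from left to right, with $x$ for a crossing of $i_1,i_2$, $y$ for $i_1,i_3$, $z$ for $i_2,i_3$. A system is regular if it has size at least $4$ and all its subsystems of size $3$ have the same non-empty signature, which is then called the signature of the regular system. A signature $\sigma$ (of a system of size $3$ in which each pair of paths crosses at least once) is extendable if there is a regular system of size $4$ with signature $\sigma$. For a word $\alpha$ on $\{x,y,z\}$, $X(\alpha),Y(\alpha),Z(\alpha)$ denote the numbers of $x$'s, $y$'s, $z$'s in $\alpha$. A non-empty word $\omega$ on $\{x,y,z\}$ is reducible if it has a non-empty proper initial substring $\omega'$ with $X(\omega')=Y(\omega')=Z(\omega')$; otherwise it is irreducible. $\cdot$ denotes concatenation. Words and tableaux $T^\omega_n$. Let $B_{(ab)}$ be the set of balanced blocks $a^rb^r$ and $b^ra^r$ ($r\ge1$), and $B_{(cd)}$ the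 set of $c^rd^r$ and $d^rc^r$ ($r\ge1$). For a set of words $L$, $L^\star$ is the set of all finite concatenations of words in $L$. Let $B_{(ab,cd)}=B_{(ab)}\cup B_{(cd)}$, and let $W_{(ab,cd)}$ be the set of words in $B_{(ab,cd)}^\star$ that are neither in $B_{(ab)}^\star$ nor in $B_{(cd)}^\star$. For $1\le i\le n$ define $\phi_{i,n}$ on blocks by: $\phi_{i,n}(a^rb^r)$ is the sequence consisting of $r$ copies of $1$, then $r$ copies of $2$, …, then $r$ copies of $i-1$ (empty if $i=1$); $\phi_{i,n}(b^ra^r)$ is $r$ copies of $i-1$, then $r$ copies of $i-2$, …, then $r$ copies of $1$ (empty if $i=1$); $\phi_{i,n}(c^rd^r)$ is $r$ copies of $i+1$, then $r$ copies of $i+2$, …, then $r$ copies of $n$ (empty if $i=n$); $\phi_{i,n}(d^rc^r)$ is $r$ copies of $n$, then $r$ copies of $n-1$, …, then $r$ copies of $i+1$ (empty if $i=n$). Extend $\phi_{i,n}$ to $B_{(ab,cd)}^\star$ by concatenation. For $n\ge 3$ set $T^\omega_n=(\phi_{1,n}(\omega),\dots,\phi_{n,n}(\omega))$. If a word $\omega\in W_{(ab,cd)}$ satisfying condition (1) exists, it is unique. *)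

(* Defs.v *)
From HB Require Import structures.
From mathcomp Require Import all_boot all_order all_algebra.
From mathcomp Require Import all_classical all_reals all_analysis.

Set Implicit Arguments.
Unset Strict Implicit.
Unset Printing Implicit Defensive.

Import Order.TTheory GRing.Theory Num.Theory.
Import numFieldNormedType.Exports.

Local Open Scope classical_set_scope.
Local Open Scope ring_scope.

Variant crossing := cr_x | cr_y | cr_z.

Definition nat_of_crossing (l : crossing) : nat :=
  match l with cr_x => 0%N | cr_y => 1%N | cr_z => 2%N end.
Definition crossing_of_nat (k : nat) : crossing :=
  match k with 0%N => cr_x | 1%N => cr_y | _ => cr_z end.
Lemma nat_of_crossingK : cancel nat_of_crossing crossing_of_nat.
Proof. by case. Qed.
HB.instance Definition _ := Countable.copy crossing (can_type nat_of_crossingK).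

Variant letter := la | lb | lc | ld.

Definition nat_of_letter (l : letter) : nat :=
  match l with la => 0%N | lb => 1%N | lc => 2%N | ld => 3%N end.
Definition letter_of_nat (k : nat) : letter :=
  match k with 0%N => la | 1%N => lb | 2%N => lc | _ => ld end.
Lemma nat_of_letterK : cancel nat_of_letter letter_of_nat.
Proof. by case. Qed.
HB.instance Definition _ := Countable.copy letter (can_type nat_of_letterK).

(* A path is represented by a function on R, of which only the restriction to
   `[0, 1] matters. *)

Definition meet_at (R : realType) (g h : R -> R) (t : R) : Prop :=
  `[0, 1]%classic t /\ g t = h t.

(* One graph passes from strictly below to strictly above the other one. *)
Definition cross_at (R : realType) (g h : R -> R) (t : R) : Prop :=
  ((\forall s \near t^'-, g s < h s) /\ (\forall s \near t^'+, h s < g s)) \/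
  ((\forall s \near t^'-, h s < g s) /\ (\forall s \near t^'+, g s < h s)).

(* A system of size n, with its paths labeled in the order of left endpoints
   from bottom to top: the path with index i : 'I_n (so 0 <= i < n) has label
   i.+1 in [n]. *)
Record is_system (R : realType) (n : nat) (f : 'I_n -> R -> R) : Prop :=
  IsSystem {
    system_size : (3 <= n)%N ;
    system_continuous : forall i, {within `[0, 1], continuous (f i)} ;
    system_left : forall i j : 'I_n, (i < j)%N -> f i 0 < f j 0 ;
    system_right : forall i j : 'I_n, i != j -> f i 1 != f j 1 ;
    system_finite : forall i j : 'I_n, i != j ->
      finite_set [set t | meet_at (f i) (f j) t] ;
    system_cross : forall (i j : 'I_n) t, i != j ->
      meet_at (f i) (f j) t -> cross_at (f i) (f j) t ;
    system_no_triple : forall (i j k : 'I_n) t,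
      i != j -> j != k -> i != k ->
      meet_at (f i) (f j) t -> ~ meet_at (f j) (f k) t
  }.

(* w lists from left to right the names of the events of E, where E t v means
   that an event named v takes place at abscissa t. The event set is finite and
   no two events are simultaneous. *)
Definition records (R : realType) (A : eqType) (E : R -> A -> Prop)
    (w : seq A) : Prop :=
  exists ev : seq (R * A),
    [/\ sorted (fun e1 e2 => e1.1 < e2.1) ev,
        forall t v, (t, v) \in ev <-> E t v
      & w = [seq e.2 | e <- ev]].

Definition is_local_sequence (R : realType) (n : nat) (f : 'I_n -> R -> R)
    (i : 'I_n) (s : seq nat) : Prop :=
  records (fun t v => exists j : 'I_n,
    [/\ v = j.+1, j != i & meet_at (f i) (f j) t]) s.

Definition is_tableau (R : realType) (n : nat) (f : 'I_n -> R -> R)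
    (T : n.-tuple (seq nat)) : Prop :=
  forall i : 'I_n, is_local_sequence f i (tnth T i).

Definition path1 : 'I_3 := @Ordinal 3 0 isT.
Definition path2 : 'I_3 := @Ordinal 3 1 isT.
Definition path3 : 'I_3 := @Ordinal 3 2 isT.

Definition crossing_pair (l : crossing) : 'I_3 * 'I_3 :=
  match l with
  | cr_x => (path1, path2)
  | cr_y => (path1, path3)
  | cr_z => (path2, path3)
  end.

Definition is_signature (R : realType) (f : 'I_3 -> R -> R)
    (w : seq crossing) : Prop :=
  records (fun t l =>
    meet_at (f (crossing_pair l).1) (f (crossing_pair l).2) t) w.

Definition signature (R : realType) (w : seq crossing) : Prop :=
  exists f : 'I_3 -> R -> R, is_system f /\ is_signature f w.

(* The subsystems of size 3 are the families f \o h with h increasing. *)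
Definition regular (R : realType) (n : nat) (f : 'I_n -> R -> R)
    (w : seq crossing) : Prop :=
  [/\ (4 <= n)%N, is_system f, w != [::]
    & forall h : 'I_3 -> 'I_n, {homo h : i j / (i < j)%N} ->
        is_signature (f \o h) w].

Definition extendable (R : realType) (w : seq crossing) : Prop :=
  exists f : 'I_4 -> R -> R, regular f w.

Definition num_X (w : seq crossing) : nat := count_mem cr_x w.
Definition num_Y (w : seq crossing) : nat := count_mem cr_y w.
Definition num_Z (w : seq crossing) : nat := count_mem cr_z w.

Definition reducible (w : seq crossing) : Prop :=
  exists w1 w2 : seq crossing,
    [/\ w = w1 ++ w2, w1 != [::], w2 != [::], num_X w1 = num_Y w1 & num_Y w1 = num_Z w1].

Definition irreducible (w : seq crossing) : Prop :=
  w != [::] /\ ~ reducible w.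

Definition balanced (l m : letter) : set (seq letter) :=
  [set w | exists r : nat, (1 <= r)%N /\
    (w = nseq r l ++ nseq r m \/ w = nseq r m ++ nseq r l)].

Definition B_ab : set (seq letter) := balanced la lb.
Definition B_cd : set (seq letter) := balanced lc ld.
Definition B_abcd : set (seq letter) := B_ab `|` B_cd.

Definition star (A : eqType) (L : set (seq A)) : set (seq A) :=
  [set w | exists ws : seq (seq A),
    (forall u, u \in ws -> L u) /\ w = flatten ws].

Definition W_abcd : set (seq letter) :=
  star B_abcd `\` (star B_ab `|` star B_cd).

Definition copies (r : nat) (s : seq nat) : seq nat :=
  flatten [seq nseq r j | j <- s].

(* A block is determined by its first letter and its length 2 r. *)
Definition phi_block (i n : nat) (u : seq letter) : seq nat :=
  let r := (size u)./2 in
  match u with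
  | [::] => [::]
  | la :: _ => copies r (iota 1%N i.-1)
  | lb :: _ => copies r (rev (iota 1%N i.-1))
  | lc :: _ => copies r (iota i.+1 (n - i))
  | ld :: _ => copies r (rev (iota i.+1 (n - i)))
  end.

(* The factorization of a word into blocks; it is unique, see block_factor_uniq
   below. *)
Definition factors (w : seq letter) : seq (seq letter) :=
  xget [::] [set ws | (forall u, u \in ws -> B_abcd u) /\ w = flatten ws].

Definition phi (i n : nat) (w : seq letter) : seq nat :=
  flatten [seq phi_block i n u | u <- factors w].

Definition Tword (w : seq letter) (n : nat) : n.-tuple (seq nat) :=
  [tuple phi i.+1 n w | i < n].

Lemma block_prefix (u v s t : seq letter) :
  B_abcd u -> B_abcd v -> u ++ s = v ++ t -> u = v.
Proof.
have E (l m l' m' : letter) r r' s' t' : l != m -> l' != m' ->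
    (0 < r)%N -> (0 < r')%N ->
    (l == l') ==> (m == m') ->
    (nseq r l ++ nseq r m) ++ s' = (nseq r' l' ++ nseq r' m') ++ t' ->
    nseq r l ++ nseq r m = nseq r' l' ++ nseq r' m'.
  case: r => // r; case: r' => // r'; move=> lm lm' _ _ + e.
  have [ll'] : l = l' /\ True by case: e.
  move=> _; subst l'; rewrite eqxx => /eqP mm; subst m'.
  suff -> : r = r' by [].
  have F k q : find (predC1 l) ((nseq k.+1 l ++ nseq k.+1 m) ++ q) = k.+1.
    rewrite -catA find_cat has_nseq /= eqxx /= size_nseq.
    by rewrite eq_sym (negPf lm) addn0.
  by have := F r s'; rewrite e F => -[].
by move=> [] [r [r0 [->|->]]] [] [r' [r'0 [->|->]]]; apply: E.
Qed.

Lemma block_factor_uniq (us vs : seq (seq letter)) :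
  (forall u, u \in us -> B_abcd u) -> (forall v, v \in vs -> B_abcd v) ->
  flatten us = flatten vs -> us = vs.
Proof.
have N u : B_abcd u -> u != [::] by move=> [] [[|r] [? [->|->]]].
elim: us vs => [|u us IH] [|v vs] //= Hu Hv.
- by have := N _ (Hv v (mem_head _ _)); case: v {Hv}.
- by have := N _ (Hu u (mem_head _ _)); case: u {Hu}.
move=> e; have uv : u = v.
  by apply: block_prefix e; [apply: Hu | apply: Hv]; rewrite mem_head.
move: e; rewrite uv => /(f_equal (drop (size v))); rewrite !drop_size_cat // => e.
by rewrite (IH vs) // => w wi; [apply: Hu | apply: Hv]; rewrite in_cons wi orbT.
Qed.

Lemma phi_flatten (i n : nat) (ws : seq (seq letter)) :
  (forall u, u \in ws -> B_abcd u) ->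
  phi i n (flatten ws) = flatten [seq phi_block i n u | u <- ws].
Proof.
move=> H; rewrite /phi; congr (flatten (map _ _)); rewrite /factors.
case: xgetP => [vs _ [Hv e]|/(_ ws) []//].
by apply: block_factor_uniq.
Qed.

Lemma phi_cat (i n : nat) (u v : seq letter) :
  star B_abcd u -> star B_abcd v -> phi i n (u ++ v) = phi i n u ++ phi i n v.
Proof.
move=> [us [Hu ->]] [vs [Hv ->]]; rewrite -flatten_cat !phi_flatten //.
  by rewrite map_cat flatten_cat.
by move=> w; rewrite mem_cat => /orP[/Hu|/Hv].
Qed.

Lemma phi_on_block (i n : nat) (u : seq letter) :
  B_abcd u -> phi i n u = phi_block i n u.
Proof.
move=> Bu; have := @phi_flatten i n [:: u].
by rewrite /= !cats0; apply => v; rewrite inE => /eqP ->.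
Qed.

Lemma phi_blockE (i n r : nat) : (0 < r)%N ->
  [/\ phi_block i n (nseq r la ++ nseq r lb) = copies r (iota 1%N i.-1),
      phi_block i n (nseq r lb ++ nseq r la) = copies r (rev (iota 1%N i.-1)),
      phi_block i n (nseq r lc ++ nseq r ld) = copies r (iota i.+1 (n - i))
    & phi_block i n (nseq r ld ++ nseq r lc) = copies r (rev (iota i.+1 (n - i)))].
Proof.
case: r => // r _.
by split; rewrite /phi_block size_cat !size_nseq addnn doubleK.
Qed.

(* Main.v *)
From HB Require Import structures.
Require Import Defs.
From mathcomp Require Import all_boot all_order all_algebra.
From mathcomp Require Import all_classical all_reals all_analysis.
From mathcomp Require Import zify lra.

(* A system of size 4 all of whose triples have signature sigma amounts to a word
   W on the six pairs of paths whose restriction to each triple is sigma.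

   Given W, the local sequence of path 4 is a word on three letters which restricts
   to the same word C on each pair of letters; this forces C, and dually the word
   of path 1, to be a product of balanced blocks, and the local sequences of paths
   2 and 3 interleave these blocks into omega.  Let (s, t) be the numbers of ab and
   cd crossings of path 2 at a boundary between blocks of omega.  If s = t at an
   inner boundary, then sigma is reducible, and a block that jumps over the
   diagonal creates a cycle in the order of the crossings; so, turning the picture
   upside down if needed, s > t at all inner boundaries.  Let p be the size of the
   first block of omega, and q that of the last one, which is a cd block.  If
   p, q < N, where N = X(sigma), then each of p + q < N and p + q > N creates a
   cycle between crossings of W, so that p + q = N, and sigma splits as in (2).

   Conversely, under (1) and (2), let path 1, then path 2, ... then path 4 sweep
   through the other ones, following the middle part of omega: this gives W.  It
   is realized by piecewise linear paths, where each crossing exchanges the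
   heights of two paths with no other path in between.  That no path lies in
   between is a parity condition on triples, which sigma satisfies since it is the
   signature of some system.

   Finally, a local sequence is determined by its restrictions to pairs of labels,
   and these are prescribed by sigma. *)

Set Implicit Arguments.
Unset Strict Implicit.
Unset Printing Implicit Defensive.

Import Order.TTheory GRing.Theory Num.Theory.
Import numFieldNormedType.Exports.

(** * Precedence in words *)

Section Before.
Variable T : eqType.
Implicit Types (w u v : seq T) (a b c : T).

(* The [m]-th occurrence of [a] in [w] precedes the [l]-th occurrence of [b],
   counting from 1; true when [m = 0 < l] or when [b] occurs less than [l] times
   and [a] at least [m] times. *)
Definition before w a m b l :=
  exists u v, [/\ w = u ++ v, (m <= count_mem a u)%N & (count_mem b u < l)%N].

Lemma cat_comparable u v u' v' : u ++ v = u' ++ v' ->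
  (exists x, u' = u ++ x) \/ (exists x, u = u' ++ x).
Proof.
elim: u u' => [|a u IH] [|a' u'] //=; try by left; eexists.
  by right; exists (a :: u).
by case=> <- /IH[[x ->]|[x ->]]; [left|right]; exists x.
Qed.

(** The prefix that witnesses [before] holds fewer than [l] letters [b], so any prefix with [l] of
    them extends it. *)
Lemma before_count w a m b l u v : before w a m b l -> w = u ++ v ->
  (l <= count_mem b u)%N -> (m <= count_mem a u)%N.
Proof.
case=> u' [v' [-> ma bl]] /cat_comparable[] [x e] lb.
  by rewrite e count_cat; lia.
by move: bl; rewrite e count_cat; lia.
Qed.

Lemma before_trans w a m b l l' c k :
  before w a m b l -> (l <= l')%N -> before w b l' c k -> before w a m c k.
Proof.
move=> ab ll' [u [v [e bl ck]]]; exists u, v; split=> //.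
by apply: before_count ab e _; apply: leq_trans bl.
Qed.

(** Used to refute cycles of precedences: a chain that returns to the same letter has to raise the
    index. *)
Lemma before_lt w a m l : before w a m a l -> (m < l)%N.
Proof. by move=> [u [v [_ h1 h2]]]; apply: leq_ltn_trans h2. Qed.

Lemma before_weak w a m b l m' l' : before w a m b l ->
  (m' <= m)%N -> (l <= l')%N -> before w a m' b l'.
Proof.
move=> [u [v [e h1 h2]]] mm ll; exists u, v.
by split=> //; [apply: leq_trans h1|apply: leq_trans ll].
Qed.

Lemma before0 w a b l : (0 < l)%N -> before w a 0 b l.
Proof. by exists [::], w. Qed.

Lemma before_all w a m b l :
  (m <= count_mem a w)%N -> (count_mem b w < l)%N -> before w a m b l.
Proof. by exists w, [::]; rewrite cats0. Qed.

Lemma before_cat u v a m b l :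
  (m <= count_mem a u)%N -> (count_mem b u < l)%N -> before (u ++ v) a m b l.
Proof. by exists u, v. Qed.

End Before.

Lemma pmap_split (S T : Type) (f : S -> option T) w u v : pmap f w = u ++ v ->
  exists u' v', [/\ w = u' ++ v', pmap f u' = u & pmap f v' = v].
Proof.
elim: w u v => [|e w IH] u v /=.
  by case: u => //= <-; exists [::], [::].
case fe: (f e) => [c|] /=; last first.
  move=> /IH [u' [v' [-> <- <-]]]; exists (e :: u'), v'.
  by split=> //=; rewrite fe.
case: u => [|c' u] /=.
  by move=> <-; exists [::], (e :: w); split=> //=; rewrite fe.
case=> <- /IH [u' [v' [-> <- <-]]]; exists (e :: u'), v'.
by split=> //=; rewrite fe.
Qed.

Lemma pmap_pmap (S T U : Type) (f : S -> option T) (g : T -> option U) w :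
  pmap g (pmap f w) = pmap (fun e => obind g (f e)) w.
Proof. by elim: w => //= e w <-; case: (f e). Qed.

Lemma pmap_map (S T U : Type) (f : S -> T) (g : T -> option U) w :
  pmap g (map f w) = pmap (g \o f) w.
Proof. by elim: w => //= e w ->. Qed.

Section BeforePmap.
Variables (S T : eqType) (f : S -> option T).

Lemma count_pmap a a' (w : seq S) : (forall e, (f e == Some a') = (e == a)) ->
  count_mem a' (pmap f w) = count_mem a w.
Proof.
move=> fa; elim: w => //= e w IH; have := fa e.
by case: (f e) => [c|] /= <-; rewrite IH //.
Qed.

(** Carries precedences from [W] to [sigma] and from [sigma] to two-letter words; the hypotheses
    make the occurrences correspond one to one. *)
Lemma before_pmap a a' b b' (w : seq S) m l :
  (forall e, (f e == Some a') = (e == a)) ->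
  (forall e, (f e == Some b') = (e == b)) ->
  before (pmap f w) a' m b' l <-> before w a m b l.
Proof.
move=> fa fb; split.
  move=> [u [v [/pmap_split [u' [v' [-> <- _]]]]]].
  by rewrite (count_pmap _ fa) (count_pmap _ fb); exists u', v'.
move=> [u [v [-> h1 h2]]]; exists (pmap f u), (pmap f v).
by rewrite pmap_cat (count_pmap _ fa) (count_pmap _ fb).
Qed.
End BeforePmap.

(** * Restrictions to two letters and coded blocks *)

Definition pair_xy c := match c with
  cr_x => Some false | cr_y => Some true | cr_z => None end.
Definition pair_xz c := match c with
  cr_x => Some false | cr_y => None | cr_z => Some true end.
Definition pair_yz c := match c with
  cr_x => None | cr_y => Some false | cr_z => Some true end.

(** The prefix whose length is the sum of the [n c] works: if it held too many of one letter, the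
    precedences would give it at least [n c] of every other letter [c], which exceeds its length. *)
Lemma crossing_cut (sigma : seq crossing) (n : crossing -> nat) :
  (forall c, n c <= count_mem c sigma)%N ->
  (forall c c', c != c' -> before sigma c (n c) c' (n c').+1) ->
  exists u v, sigma = u ++ v /\ forall c, count_mem c u = n c.
Proof.
move=> le_n bef.
have sz w : size w = (count_mem cr_x w + count_mem cr_y w + count_mem cr_z w)%N.
  by elim: w => //= -[] w -> /=; lia.
set k := (n cr_x + n cr_y + n cr_z)%N.
exists (take k sigma), (drop k sigma); rewrite cat_take_drop; split=> //.
have := sz (take k sigma); rewrite size_takel; last first.
  by rewrite sz /k; have := le_n cr_x; have := le_n cr_y; have := le_n cr_z; lia.
have cmp c c' : c != c' -> (n c' < count_mem c' (take k sigma))%N ->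
    (n c <= count_mem c (take k sigma))%N.
  by move=> cc'; apply: before_count (bef _ _ cc') (esym (cat_take_drop k sigma)).
have := cmp cr_x cr_y isT; have := cmp cr_x cr_z isT; have := cmp cr_y cr_x isT.
have := cmp cr_y cr_z isT; have := cmp cr_z cr_x isT; have := cmp cr_z cr_y isT.
rewrite /k => ? ? ? ? ? ? ?; case; lia.
Qed.

(* [(k, o, r)] encodes a balanced block of size [r], on the letters c, d if [k]
   and a, b otherwise, which starts with its second letter when [ o]. *)
Definition block := (bool * bool * nat)%type.

Definition ab_sum (ws : seq block) :=
  sumn [seq if b.1.1 then 0%N else b.2 | b <- ws].
Definition cd_sum (ws : seq block) :=
  sumn [seq if b.1.1 then b.2 else 0%N | b <- ws].

Definition halves (o : bool) r := nseq r o ++ nseq r (~~ o).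

(* The words into which [omega] forces the restrictions of the signature to two
   letters, the alphabetically first of which is coded by [false]. *)
Definition xy_word (ws : seq block) :=
  flatten [seq if b.1.1 then halves b.1.2 b.2 else [::] | b <- ws].
Definition xz_word (ws : seq block) := flatten [seq nseq b.2 b.1.1 | b <- ws].
Definition yz_word (ws : seq block) :=
  flatten [seq if b.1.1 then [::] else halves b.1.2 b.2 | b <- ws].

Lemma ab_sum_cat ws1 ws2 : ab_sum (ws1 ++ ws2) = (ab_sum ws1 + ab_sum ws2)%N.
Proof. by rewrite /ab_sum map_cat sumn_cat. Qed.
Lemma cd_sum_cat ws1 ws2 : cd_sum (ws1 ++ ws2) = (cd_sum ws1 + cd_sum ws2)%N.
Proof. by rewrite /cd_sum map_cat sumn_cat. Qed.
Lemma xy_word_cat ws1 ws2 : xy_word (ws1 ++ ws2) = xy_word ws1 ++ xy_word ws2.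
Proof. by rewrite /xy_word map_cat flatten_cat. Qed.
Lemma xz_word_cat ws1 ws2 : xz_word (ws1 ++ ws2) = xz_word ws1 ++ xz_word ws2.
Proof. by rewrite /xz_word map_cat flatten_cat. Qed.
Lemma yz_word_cat ws1 ws2 : yz_word (ws1 ++ ws2) = yz_word ws1 ++ yz_word ws2.
Proof. by rewrite /yz_word map_cat flatten_cat. Qed.

Lemma count_halves a o r : count_mem a (halves o r) = r.
Proof. by rewrite count_cat !count_nseq /=; case: a o => [] [] /=; lia. Qed.

Lemma count_xy_word a ws : count_mem a (xy_word ws) = cd_sum ws.
Proof.
elim: ws => //= -[[[] o] r] ws; rewrite /xy_word /cd_sum /= => IH //.
by rewrite count_cat count_halves IH.
Qed.

Lemma count_yz_word a ws : count_mem a (yz_word ws) = ab_sum ws.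
Proof.
elim: ws => //= -[[[] o] r] ws; rewrite /yz_word /ab_sum /= => IH //.
by rewrite count_cat count_halves IH.
Qed.

Lemma count_xz_word a ws :
  count_mem a (xz_word ws) = if a then cd_sum ws else ab_sum ws.
Proof.
elim: ws => [|[[k o] r] ws]; first by case: a.
rewrite /xz_word /ab_sum /cd_sum /= => IH.
by rewrite count_cat count_nseq IH; case: a k {IH} => [] [] /=; lia.
Qed.

Lemma cd_sum_block ws m : (0 < m <= cd_sum ws)%N ->
  exists ws1 o r ws2, ws = ws1 ++ (true, o, r) :: ws2 /\
    (cd_sum ws1 < m <= cd_sum ws1 + r)%N.
Proof.
elim: ws m => [|[[k o] r] ws IH] m; first by rewrite /cd_sum /=; lia.
case: k; last first.
  by move=> /IH [ws1 [q1 [r1 [ws2 [-> h]]]]]; exists ((false, o, r) :: ws1), q1, r1, ws2.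
case: (leqP m r) => [mr /andP[m0 _]|rm].
  by exists [::], o, r, ws; rewrite /cd_sum /= m0 add0n.
rewrite {1}/cd_sum /= -/(cd_sum ws) => mle.
have /IH [ws1 [q1 [r1 [ws2 [-> h]]]]] : (0 < m - r <= cd_sum ws)%N by lia.
exists ((true, o, r) :: ws1), q1, r1, ws2; split=> //.
by rewrite /cd_sum /= -/(cd_sum ws1); lia.
Qed.

Lemma ab_sum_block ws m : (0 < m <= ab_sum ws)%N ->
  exists ws1 o r ws2, ws = ws1 ++ (false, o, r) :: ws2 /\
    (ab_sum ws1 < m <= ab_sum ws1 + r)%N.
Proof.
elim: ws m => [|[[k o] r] ws IH] m; first by rewrite /ab_sum /=; lia.
case: k.
  by move=> /IH [ws1 [q1 [r1 [ws2 [-> h]]]]]; exists ((true, o, r) :: ws1), q1, r1, ws2.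
case: (leqP m r) => [mr /andP[m0 _]|rm].
  by exists [::], o, r, ws; rewrite /ab_sum /= m0 add0n.
rewrite {1}/ab_sum /= -/(ab_sum ws) => mle.
have /IH [ws1 [q1 [r1 [ws2 [-> h]]]]] : (0 < m - r <= ab_sum ws)%N by lia.
exists ((false, o, r) :: ws1), q1, r1, ws2; split=> //.
by rewrite /ab_sum /= -/(ab_sum ws1); lia.
Qed.

(** * Condition (2) is necessary *)

Variant pair4 := p12 | p13 | p14 | p23 | p24 | p34.

Definition nat_of_pair4 e := match e with
  p12 => 0%N | p13 => 1%N | p14 => 2%N | p23 => 3%N | p24 => 4%N | p34 => 5%N end.
Definition pair4_of_nat k := match k with
  0%N => p12 | 1%N => p13 | 2%N => p14 | 3%N => p23 | 4%N => p24 | _ => p34 end.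
Lemma nat_of_pair4K : cancel nat_of_pair4 pair4_of_nat.
Proof. by case. Qed.
HB.instance Definition _ := Countable.copy pair4 (can_type nat_of_pair4K).

Definition in123 e := match e with
  p12 => Some cr_x | p13 => Some cr_y | p23 => Some cr_z | _ => None end.
Definition in124 e := match e with
  p12 => Some cr_x | p14 => Some cr_y | p24 => Some cr_z | _ => None end.
Definition in134 e := match e with
  p13 => Some cr_x | p14 => Some cr_y | p34 => Some cr_z | _ => None end.
Definition in234 e := match e with
  p23 => Some cr_x | p24 => Some cr_y | p34 => Some cr_z | _ => None end.

(* [W] lists the crossings of a system of size 4 whose triples have signature
   [sigma]; [pij] is a crossing of paths [i] and [j]. *)
Definition extension4 (sigma : seq crossing) (W : seq pair4) :=
  [/\ pmap in123 W = sigma, pmap in124 W = sigma,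
      pmap in134 W = sigma & pmap in234 W = sigma].

(* [omega], coded by [ws], satisfies condition (1). *)
Definition block_code (sigma : seq crossing) (ws : seq block) :=
  [/\ pmap pair_xy sigma = xy_word ws, pmap pair_xz sigma = xz_word ws
    & pmap pair_yz sigma = yz_word ws].

Section Necessity.
Variables (sigma : seq crossing) (ws : seq block).
Hypothesis ws_pos : all (fun b => 0 < b.2)%N ws.
Hypothesis ws_code : block_code sigma ws.

Let count_x : count_mem cr_x sigma = ab_sum ws /\ count_mem cr_x sigma = cd_sum ws.
Proof.
case: ws_code => exy exz _; split.
  by rewrite -(@count_pmap _ _ pair_xz cr_x false) ?exz ?count_xz_word //; case.
by rewrite -(@count_pmap _ _ pair_xy cr_x false) ?exy ?count_xy_word //; case.
Qed.

Let count_y : count_mem cr_y sigma = cd_sum ws.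
Proof.
case: ws_code => exy _ _.
by rewrite -(@count_pmap _ _ pair_xy cr_y true) ?exy ?count_xy_word //; case.
Qed.

Let count_z : count_mem cr_z sigma = cd_sum ws.
Proof.
case: ws_code => _ exz _.
by rewrite -(@count_pmap _ _ pair_xz cr_z true) ?exz ?count_xz_word //; case.
Qed.

Let N := cd_sum ws.
Let ab_sumN : ab_sum ws = N. Proof. by case: count_x => <- ->. Qed.
Let countN c : count_mem c sigma = N.
Proof. by case: c; rewrite ?count_y ?count_z //; case: count_x. Qed.

(** Let s = [ab_sum ws1] and t = [cd_sum ws1] at a boundary between blocks. The blocks before it
    contribute t letters of each kind to [xy_word], s of each kind to [yz_word], and s x's and t z's
    to [xz_word]. This gives the four [cut] lemmas. *)
Lemma cut_xy ws1 ws2 m l : ws = ws1 ++ ws2 -> (m <= cd_sum ws1 < l)%N ->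
  before sigma cr_x m cr_y l /\ before sigma cr_y m cr_x l.
Proof.
move=> e /andP[ml lm]; case: ws_code => exy _ _.
split; [apply/(@before_pmap _ _ pair_xy cr_x false cr_y true)
       |apply/(@before_pmap _ _ pair_xy cr_y true cr_x false)]; try by case.
all: by rewrite exy e xy_word_cat; apply: before_cat; rewrite count_xy_word.
Qed.

Lemma cut_yz ws1 ws2 m l : ws = ws1 ++ ws2 -> (m <= ab_sum ws1 < l)%N ->
  before sigma cr_y m cr_z l /\ before sigma cr_z m cr_y l.
Proof.
move=> e /andP[ml lm]; case: ws_code => _ _ eyz.
split; [apply/(@before_pmap _ _ pair_yz cr_y false cr_z true)
       |apply/(@before_pmap _ _ pair_yz cr_z true cr_y false)]; try by case.
all: by rewrite eyz e yz_word_cat; apply: before_cat; rewrite count_yz_word.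
Qed.

Lemma cut_xz ws1 ws2 m l : ws = ws1 ++ ws2 ->
  (m <= ab_sum ws1)%N -> (cd_sum ws1 < l)%N -> before sigma cr_x m cr_z l.
Proof.
move=> e ml lm; case: ws_code => _ exz _.
apply/(@before_pmap _ _ pair_xz cr_x false cr_z true); try by case.
by rewrite exz e xz_word_cat; apply: before_cat; rewrite count_xz_word.
Qed.

Lemma cut_zx ws1 ws2 m l : ws = ws1 ++ ws2 ->
  (m <= cd_sum ws1)%N -> (ab_sum ws1 < l)%N -> before sigma cr_z m cr_x l.
Proof.
move=> e ml lm; case: ws_code => _ exz _.
apply/(@before_pmap _ _ pair_xz cr_z true cr_x false); try by case.
by rewrite exz e xz_word_cat; apply: before_cat; rewrite count_xz_word.
Qed.

(** The first half of the block brings one letter up to number [cd_sum ws1 + r] while the other one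
    still stands at [cd_sum ws1]. *)
Lemma cd_block ws1 (o : bool) r ws2 m l : ws = ws1 ++ (true, o, r) :: ws2 ->
  (m <= cd_sum ws1 + r)%N -> (cd_sum ws1 < l)%N ->
  if o then before sigma cr_y m cr_x l else before sigma cr_x m cr_y l.
Proof.
move=> e ml lm; case: ws_code => exy _ _; move: exy.
rewrite e xy_word_cat /xy_word /= -/(xy_word ws1) -/(xy_word ws2) /halves.
rewrite -!catA catA => exy.
case: o e exy => e exy;
  [apply/(@before_pmap _ _ pair_xy cr_y true cr_x false)
  |apply/(@before_pmap _ _ pair_xy cr_x false cr_y true)]; try by case.
all: by rewrite exy; apply: before_cat;
  rewrite count_cat count_xy_word count_nseq /=; lia.
Qed.

Lemma ab_block ws1 (o : bool) r ws2 m l : ws = ws1 ++ (false, o, r) :: ws2 ->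
  (m <= ab_sum ws1 + r)%N -> (ab_sum ws1 < l)%N ->
  if o then before sigma cr_z m cr_y l else before sigma cr_y m cr_z l.
Proof.
move=> e ml lm; case: ws_code => _ _ eyz; move: eyz.
rewrite e yz_word_cat /yz_word /= -/(yz_word ws1) -/(yz_word ws2) /halves.
rewrite -!catA catA => eyz.
case: o e eyz => e eyz;
  [apply/(@before_pmap _ _ pair_yz cr_z true cr_y false)
  |apply/(@before_pmap _ _ pair_yz cr_y false cr_z true)]; try by case.
all: by rewrite eyz; apply: before_cat;
  rewrite count_cat count_yz_word count_nseq /=; lia.
Qed.

Hypothesis sigma_irr : irreducible sigma.

Lemma sum_gt0 (ws1 : seq block) : {subset ws1 <= ws} -> ws1 != [::] ->
  (0 < ab_sum ws1 + cd_sum ws1)%N.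
Proof.
case: ws1 => // -[[k o] r] ws1 sub _.
have := allP ws_pos _ (sub _ (mem_head _ _)).
by rewrite /ab_sum /cd_sum /=; case: k {sub}; lia.
Qed.

(** If s = t, then [crossing_cut] yields a prefix with s letters of each kind, which reduces
    [sigma]; blocks of positive size on both sides make it non-empty and proper. *)
Lemma cut_neq ws1 ws2 : ws = ws1 ++ ws2 -> ws1 != [::] -> ws2 != [::] ->
  ab_sum ws1 <> cd_sum ws1.
Proof.
move=> e n1 n2 st.
have p1 : (0 < ab_sum ws1 + cd_sum ws1)%N.
  by apply: sum_gt0 => // b b1; rewrite e mem_cat b1.
have p2 : (0 < ab_sum ws2 + cd_sum ws2)%N.
  by apply: sum_gt0 => // b b1; rewrite e mem_cat b1 orbT.
have sN : ab_sum ws1 + ab_sum ws2 = N by rewrite -ab_sumN e ab_sum_cat.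
have tN : cd_sum ws1 + cd_sum ws2 = N by rewrite /N e cd_sum_cat.
have [|c c' cc'|u [v [ec uc]]] := @crossing_cut sigma (fun=> cd_sum ws1).
- by move=> c; rewrite countN; lia.
- have [h1 h2] := @cut_xy ws1 ws2 (cd_sum ws1) (cd_sum ws1).+1 e ltac:(lia).
  have [h3 h4] := @cut_yz ws1 ws2 (cd_sum ws1) (cd_sum ws1).+1 e ltac:(lia).
  have h5 := @cut_xz ws1 ws2 (cd_sum ws1) (cd_sum ws1).+1 e ltac:(lia) ltac:(lia).
  have h6 := @cut_zx ws1 ws2 (cd_sum ws1) (cd_sum ws1).+1 e ltac:(lia) ltac:(lia).
  by case: c c' cc' => [] [].
case: sigma_irr => _; apply; exists u, v; split=> //.
- by apply/eqP => u0; have := uc cr_x; rewrite u0 /=; lia.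
- apply/eqP => v0; have := countN cr_x.
  by rewrite ec v0 cats0 uc; lia.
- by rewrite /num_X /num_Y !uc.
- by rewrite /num_Z /num_Y !uc.
Qed.

Variables (q1 : bool) (p : nat) (wt : seq block).
Hypothesis ws_head : ws = (false, q1, p) :: wt.

(** Induction on the boundary. The first block gives s = p > 0 = t, and ab blocks only raise s. A cd
    block reaching t + r >= s would jump over the diagonal, since [cut_neq] excludes equality. *)
Lemma cut_below ws1 ws2 : ws = ws1 ++ ws2 -> ws1 != [::] -> ws2 != [::] ->
  (cd_sum ws1 < ab_sum ws1)%N.
Proof.
elim/last_ind: ws1 ws2 => // ws1 [[k o] r] IH ws2.
rewrite cat_rcons => e _ n2.
have r0 : (0 < r)%N.
  by apply: (allP ws_pos (k, o, r)); rewrite e mem_cat mem_head orbT.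
have := @cut_neq (rcons ws1 (k, o, r)) ws2; rewrite cat_rcons.
move=> /(_ e _ n2); rewrite -size_eq0 size_rcons => /(_ isT).
have [n1|n1] := eqVneq ws1 [::].
  move: e; rewrite n1 ws_head /= => -[<- _ _ _].
  by rewrite /ab_sum /cd_sum /=; lia.
have {IH} := IH _ e n1 isT.
rewrite -cats1 ab_sum_cat cd_sum_cat.
case: k e; rewrite /(ab_sum [:: _]) /(cd_sum [:: _]) /= => e; last by lia.
rewrite !addn0 => lt1 neq; case: ltnP => // le; exfalso.
set s := ab_sum ws1 in lt1 neq le *; set t := cd_sum ws1 in lt1 neq le *.
have e' : ws = rcons ws1 (true, o, r) ++ ws2 by rewrite cat_rcons.
have sr : ab_sum (rcons ws1 (true, o, r)) = s.
  by rewrite -cats1 ab_sum_cat /(ab_sum [:: _]) /= /s; lia.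
have tr : cd_sum (rcons ws1 (true, o, r)) = (t + r)%N.
  by rewrite -cats1 cd_sum_cat /(cd_sum [:: _]) /= /t; lia.
(* The cycle is y_(s+1) < x_s < z_s < y_(s+1) if the block has its y's first, and z_(s+1) < x_(s+1)
   < y_s < z_(s+1) if it has its x's first. *)
have [yz zy] := @cut_yz ws1 _ s s.+1 e ltac:(rewrite /s; lia).
have xz := @cut_xz ws1 _ s s e ltac:(rewrite /s; lia) ltac:(rewrite -/t; lia).
have zx := @cut_zx _ _ s.+1 s.+1 e' ltac:(rewrite tr; lia) ltac:(rewrite sr; lia).
case: o {e' sr tr zx} e (zx) => e zx.
  have yx := @cd_block ws1 true r ws2 s.+1 s e ltac:(rewrite -/t; lia) ltac:(rewrite -/t; lia).
  have := before_trans (before_trans yx (leqnn _) xz) (leqnn _) zy.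
  by move/before_lt; rewrite ltnn.
have xy := @cd_block ws1 false r ws2 s.+1 s e ltac:(rewrite -/t; lia) ltac:(rewrite -/t; lia).
have := before_trans (before_trans zx (leqnn _) xy) (leqnn _) yz.
by move/before_lt; rewrite ltnn.
Qed.

(** Both sums end at [N], while s > t before the last block; hence that block is a cd block. *)
Lemma ws_last : exists wi o q, [/\ ws = (false, q1, p) :: rcons wi (true, o, q),
  (cd_sum wi + q = N)%N, (p + ab_sum wi = N)%N, (0 < p)%N & (0 < q)%N].
Proof.
have p0 : (0 < p)%N by apply: (allP ws_pos (false, q1, p)); rewrite ws_head mem_head.
case/lastP: wt ws_head => [|wi [[k o] q]] e.
  by move: ab_sumN; rewrite /N e /ab_sum /cd_sum /=; lia.
have q0 : (0 < q)%N.
  by apply: (allP ws_pos (k, o, q)); rewrite e inE mem_rcons mem_head orbT.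
have e' : ws = ((false, q1, p) :: wi) ++ [:: (k, o, q)] by rewrite e cats1.
have lt := cut_below e' isT isT.
have := ab_sumN; rewrite e' ab_sum_cat /(ab_sum [:: _]) /=.
have : cd_sum ws = N by []; rewrite {1}e' cd_sum_cat /(cd_sum [:: _]) /= => e1 e2.
case: k e e' e1 e2 => e e' e1 e2; last by exfalso; move: lt e1 e2; clear; lia.
exists wi, o, q; split=> //; first by rewrite -cats1.
- by move: e1; rewrite /cd_sum /=; lia.
- by move: e2; rewrite /ab_sum /=; lia.
Qed.

Let N_gt0 : (0 < N)%N. Proof. by case: ws_last => wi [ o [q [_]]]; lia. Qed.

(** The hypotheses allow two cuts of [sigma], after (P, P, 0) and after (N, P, P) letters x, y, z;
    the three parts are then as in (2), with Q = N - P. *)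
Lemma three_parts P : (P <= N)%N ->
  before sigma cr_x P cr_y P.+1 -> before sigma cr_y P cr_x P.+1 ->
  before sigma cr_x P cr_z 1 -> before sigma cr_y P cr_z 1 ->
  before sigma cr_x N cr_y P.+1 -> before sigma cr_x N cr_z P.+1 ->
  before sigma cr_y P cr_z P.+1 -> before sigma cr_z P cr_y P.+1 ->
  exists alpha beta gamma P Q,
    [/\ sigma = alpha ++ beta ++ gamma,
        (num_X alpha, num_Y alpha, num_Z alpha) = (P, P, 0%N),
        (num_X beta, num_Y beta, num_Z beta) = (Q, 0%N, P),
        (num_X gamma, num_Y gamma, num_Z gamma) = (0%N, Q, Q)
      & ~ (P = 0%N /\ Q = 0%N)].
Proof.
move=> PN xy yx xz yz xNy xNz yPz zPy.
have all_before c c' m : (m <= N)%N -> before sigma c m c' N.+1.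
  by move=> mN; apply: before_all; rewrite countN.
have [|c c' cc'|u1 [v1 [eu1 c1]]] := @crossing_cut sigma
    (fun c => match c with cr_z => 0%N | _ => P end).
- by move=> c; rewrite countN; case: c.
- by case: c c' cc' => [] [] // _; apply: before0.
have [|c c' cc'|u2 [v2 [eu2 c2]]] := @crossing_cut sigma
    (fun c => match c with cr_x => N | _ => P end).
- by move=> c; rewrite countN; case: c.
- by case: c c' cc' => [] [] // _; apply: all_before.
(* Were [u2] the shorter prefix, the x's would give P = N and the z's P = 0, against N > 0. *)
have [x eu] : exists x, u2 = u1 ++ x.
  have := eu1; rewrite eu2 => /cat_comparable [[x eu]|]; last by [].
  exists [::]; rewrite cats0; move: eu (c1 cr_x) (c1 cr_z) N_gt0.
  move=> ->; rewrite !count_cat !c2; lia.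
have cx c : count_mem c u1 + count_mem c x = count_mem c u2 by rewrite eu count_cat.
have cv c : count_mem c u2 + count_mem c v2 = N by rewrite -(countN c) eu2 count_cat.
exists u1, x, v2, P, (N - P)%N; rewrite /num_X /num_Y /num_Z.
have := (cx cr_x, cx cr_y, cx cr_z, cv cr_x, cv cr_y, cv cr_z).
rewrite !c1 !c2 => -[[[[[x1 x2] x3] x4] x5] x6]; split.
- by rewrite eu2 eu catA.
- by [].
- by congr (_, _, _); lia.
- by congr (_, _, _); lia.
- by lia.
Qed.

Variable W : seq pair4.
Hypothesis W_ext : extension4 sigma W.

Let ext123 e f c d m l : in123 e = Some c -> in123 f = Some d ->
  before sigma c m d l <-> before W e m f l.
Proof.
by case: W_ext => <- _ _ _ ec fd;
  apply: before_pmap; [case: e ec|case: f fd] => // -[<-] [].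
Qed.
Let ext124 e f c d m l : in124 e = Some c -> in124 f = Some d ->
  before sigma c m d l <-> before W e m f l.
Proof.
by case: W_ext => _ <- _ _ ec fd;
  apply: before_pmap; [case: e ec|case: f fd] => // -[<-] [].
Qed.
Let ext134 e f c d m l : in134 e = Some c -> in134 f = Some d ->
  before sigma c m d l <-> before W e m f l.
Proof.
by case: W_ext => _ _ <- _ ec fd;
  apply: before_pmap; [case: e ec|case: f fd] => // -[<-] [].
Qed.
Let ext234 e f c d m l : in234 e = Some c -> in234 f = Some d ->
  before sigma c m d l <-> before W e m f l.
Proof.
by case: W_ext => _ _ _ <- ec fd;
  apply: before_pmap; [case: e ec|case: f fd] => // -[<-] [].
Qed.

Lemma condition2_ab : exists alpha beta gamma P Q,
    [/\ sigma = alpha ++ beta ++ gamma,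
        (num_X alpha, num_Y alpha, num_Z alpha) = (P, P, 0%N),
        (num_X beta, num_Y beta, num_Z beta) = (Q, 0%N, P),
        (num_X gamma, num_Y gamma, num_Z gamma) = (0%N, Q, Q)
      & ~ (P = 0%N /\ Q = 0%N)].
Proof.
have [wi [ o [q [ews qN pN p0 q0]]]] := ws_last.
have all_before c c' m l : (m <= N)%N -> (N < l)%N -> before sigma c m c' l.
  by move=> mN lN; apply: before_all; rewrite countN.
set hd := (false, q1, p) in ews; set lst := (true, o, q) in ews.
have e1 : ws = [:: hd] ++ rcons wi lst by [].
have e1' : ws = [::] ++ hd :: rcons wi lst by [].
have e2 : ws = (hd :: wi) ++ [:: lst] by rewrite ews cats1.
have s1 : ab_sum [:: hd] = p by rewrite /ab_sum /= addn0.
have t1 : cd_sum [:: hd] = 0%N by [].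
have s2 : ab_sum (hd :: wi) = N by rewrite -pN.
have t2 : cd_sum (hd :: wi) = (N - q)%N by rewrite -qN addnK.
have lt2 := cut_below e2 isT isT.
(* As s > t, path 2 meets the crossings z of an inner cd block only after all
   the crossings x of the block, and even after the next one. *)
have cd_inner m : (0 < m <= N - q)%N -> exists ws1 o' r ws2,
    [/\ ws = ws1 ++ (true, o', r) :: ws2,
        (cd_sum ws1 < m <= cd_sum ws1 + r)%N, (cd_sum ws1 + r <= N - q)%N
      & before sigma cr_x (cd_sum ws1 + r).+1 cr_z (cd_sum ws1).+1].
  rewrite -t2 => /cd_sum_block [ws1 [ o' [r [ws2 [ei mr]]]]].
  have e3 : ws = ws1 ++ (true, o', r) :: rcons ws2 lst.
    by rewrite e2 ei -catA /= cats1.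
  have e4 : ws = rcons ws1 (true, o', r) ++ rcons ws2 lst by rewrite cat_rcons.
  have := cut_below e4; rewrite -!size_eq0 !size_rcons => /(_ isT isT).
  rewrite -cats1 ab_sum_cat cd_sum_cat /(ab_sum [:: _]) /(cd_sum [:: _]) /= !addn0.
  move=> lt3; exists ws1, o', r, (rcons ws2 lst); split=> //.
    by rewrite ei cd_sum_cat /(cd_sum (_ :: _)) /=; lia.
  by apply: cut_xz e3 _ _ => //; lia.
(* With s and t taken before the ab block of the m-th a, the chain is x_m < z_(t+1) <= z_s < y_(s+1)
   <= y_m. As m > p, this is not the first block, before which s = t = 0. *)
have x_before_y m : (p < m <= N)%N -> before sigma cr_x m cr_y m.
  rewrite -ab_sumN => /andP[pm mN].
  have [|ws1 [ o' [r [ws2 [e3 mr]]]]] := @ab_sum_block ws m; first by lia.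
  have n1 : ws1 != [::].
    apply/eqP => w0; move: e3 mr; rewrite w0 ews /= => -[_ <- _].
    by rewrite /ab_sum /=; lia.
  have lt3 := cut_below e3 n1 isT.
  have e4 : ws = rcons ws1 (false, o', r) ++ ws2 by rewrite cat_rcons.
  have xz := @cut_xz _ _ m (cd_sum ws1).+1 e4.
  rewrite -cats1 ab_sum_cat cd_sum_cat /(ab_sum [:: _]) /(cd_sum [:: _]) /= in xz.
  have {}xz := xz ltac:(lia) ltac:(lia).
  have [_ zy] := @cut_yz ws1 _ (ab_sum ws1) (ab_sum ws1).+1 e3 ltac:(lia).
  by apply: before_weak (before_trans xz lt3 zy) _ _ => //; lia.
(* With t and t + r taken before and after the cd block of the m-th c, the chain is y_m <= y_(t+r) <
   x_(t+r+1) < z_(t+1) <= z_m. *)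
have y_before_z m : (0 < m <= N - q)%N -> before sigma cr_y m cr_z m.
  move=> /cd_inner [ws1 [ o' [r [ws2 [e3 mr rN xz]]]]].
  have e4 : ws = rcons ws1 (true, o', r) ++ ws2 by rewrite cat_rcons.
  have [_] := @cut_xy _ _ m (cd_sum ws1 + r).+1 e4 ltac:(rewrite -cats1 cd_sum_cat
    /(cd_sum [:: _]) /=; lia).
  move=> yx; have := before_trans yx (leqnn _) xz.
  by move=> h; apply: before_weak h _ _ => //; lia.
have xz1 : before sigma cr_x p cr_z 1.
  by apply: cut_xz e1 _ _; rewrite ?s1 ?t1.
have xNz : before sigma cr_x N cr_z (N - q).+1.
  by apply: cut_xz e2 _ _; rewrite ?s2 ?t2.
have blk1 l : (0 < l)%N ->
    if q1 then before sigma cr_z p cr_y l else before sigma cr_y p cr_z l.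
  by move=> l0; apply: ab_block e1' _ _.
have blk2 l : (N - q < l)%N ->
    if o then before sigma cr_y N cr_x l else before sigma cr_x N cr_y l.
  by move=> l0; apply: cd_block e2 _ _; rewrite t2 //; lia.
have [yz2 zy2] : before sigma cr_y p cr_z p.+1 /\ before sigma cr_z p cr_y p.+1.
  by apply: cut_yz e1 _; rewrite s1 leqnn ltnSn.
have [xy2 yx2] : before sigma cr_x (N - q) cr_y (N - q).+1 /\
    before sigma cr_y (N - q) cr_x (N - q).+1.
  by apply: cut_xy e2 _; rewrite t2 leqnn ltnSn.
(* If the d's come first in the last block, then y_N precedes x_N, which [x_before_y] forbids unless
   p = N. Dually, a first block that starts with its b's forces q = N. *)
have o_pN : o -> p = N.
  move=> oT; apply/eqP; apply: contraT => pn; move: blk2; rewrite oT.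
  move=> /(_ N ltac:(lia)) yx.
  by have := before_trans yx (leqnn _) (x_before_y N ltac:(lia)) => /before_lt; rewrite ltnn.
have q1_qN : q1 -> q = N.
  move=> oT; apply/eqP; apply: contraT => qn; move: blk1; rewrite oT.
  move=> /(_ 1%N isT) zy.
  have := before_trans (y_before_z 1%N ltac:(lia)) p0 zy.
  by move/before_lt.
(* The degenerate splits come first: P = N and Q = 0, then P = 0 and Q = N. *)
case: (boolP (~~ q1 && (p == N))) => [/andP[nq1 /eqP pe]|h1].
  rewrite (negPf nq1) in blk1; apply: (three_parts (P := N)) => //.
  - exact: all_before.
  - exact: all_before.
  - by rewrite -pe.
  - by rewrite -{1}pe; apply: blk1.
  - exact: all_before.
  - exact: all_before.
  - exact: all_before.
  - exact: all_before.
case: (boolP (~~ o && (q == N))) => [/andP[no /eqP qe]|h2].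
  rewrite (negPf no) in blk2; apply: (three_parts (P := 0)) => //; try exact: before0.
    by apply: blk2; lia.
  by move: xNz; rewrite qe subnn.
(* If [o] held, then p = N, so [q1] holds by [h1], so q = N; this gives the cycle y_N < x_1 <= x_p <
   z_1 <= z_p < y_1. *)
have oF : o = false.
  apply/negP => oT; move: h1 (blk2); rewrite o_pN // oT eqxx andbT negbK => q1T yx.
  move: (blk1); rewrite q1T => zy; have qe := q1_qN q1T.
  have {}yx := yx 1%N ltac:(lia); have {}zy := zy 1%N isT.
  have := before_trans (before_trans yx p0 xz1) p0 zy.
  by move/before_lt; lia.
have q1F : q1 = false.
  by apply/negP => q1T; move: h2; rewrite oF q1_qN // eqxx.
rewrite oF q1F /= in h1 h2 blk1 blk2.
have [pq|pq] := eqVneq p (N - q)%N.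
  rewrite -pq in xNz xy2 yx2 blk2.
  by apply: (three_parts _ xy2 yx2 xz1 (blk1 _ _) (blk2 _ _) xNz yz2 zy2) => //; lia.
exfalso.
have [ltp|ltp] : (p < N - q)%N \/ (N - q < p)%N by lia.
  (* With t the end of the cd block containing p + 1, there is the cycle
     34_p < 14_(p+1) <= 14_t < 12_(t+1) < 23_(p+1) < 34_p. *)
  have [ws1 [ o' [r [ws2 [e3 mr rN xz]]]]] := cd_inner p.+1 ltac:(lia).
  set t := (cd_sum ws1 + r)%N in mr rN xz.
  have e4 : ws = rcons ws1 (true, o', r) ++ ws2 by rewrite cat_rcons.
  have [_ yx] := @cut_xy _ _ t t.+1 e4 ltac:(rewrite -cats1 cd_sum_cat
    /(cd_sum [:: _]) /= /t; lia).
  have b1 : before W p34 p p14 p.+1 by apply/(@ext134 _ _ cr_z cr_y).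
  have b2 : before W p14 t p12 t.+1 by apply/(@ext124 _ _ cr_y cr_x).
  have b3 : before W p12 t.+1 p23 (cd_sum ws1).+1 by apply/(@ext123 _ _ cr_x cr_z).
  have [ws1' [ o'' [r' [ws2' [e3' mr' rN' xz']]]]] := cd_inner p ltac:(lia).
  have b4 : before W p23 p.+1 p34 p.
    apply/(@ext234 _ _ cr_x cr_z) => //; apply: before_weak xz' _ _; lia.
  have b12 := before_trans b1 (_ : p.+1 <= t)%N b2.
  have b34 := before_trans b3 (_ : (cd_sum ws1).+1 <= p.+1)%N b4.
  have := before_trans (b12 ltac:(lia)) (leqnn _) (b34 ltac:(lia)).
  by move/before_lt; rewrite ltnn.
(* The cycle is 13_N < 14_(N-q+1) <= 14_p < 24_1 <= 24_(N-q) < 23_(N-q+1) <= 23_p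
   < 13_(p+1) <= 13_N. *)
have b1 : before W p13 N p14 (N - q).+1.
  by apply/(@ext134 _ _ cr_x cr_y) => //; apply: blk2.
have b2 : before W p14 p p24 1 by apply/(@ext124 _ _ cr_y cr_z) => //; apply: blk1.
have b3 : before W p24 (N - q) p23 (N - q).+1 by apply/(@ext234 _ _ cr_y cr_x).
have b4 : before W p23 p p13 p.+1 by apply/(@ext123 _ _ cr_z cr_y).
have qltN : (q < N)%N by lia.
have c1 := before_trans b1 ltp b2.
have c2 := before_trans c1 (_ : 1 <= N - q)%N b3.
have := before_trans (c2 ltac:(lia)) ltp b4.
by move/before_lt; lia.
Qed.
End Necessity.

(** * Condition (1) is necessary *)

Section Restriction.
Variable T : eqType.
Implicit Types (w u v : seq T) (a b c : T).

Definition restr a b w : seq bool :=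
  pmap (fun e => if e == a then Some false else if e == b then Some true else None) w.

Lemma restr_cat a b u v : restr a b (u ++ v) = restr a b u ++ restr a b v.
Proof. exact: pmap_cat. Qed.

Lemma restr_nseq a b r c : restr a b (nseq r c) =
  if c == a then nseq r false else if c == b then nseq r true else [::].
Proof.
rewrite /restr; case: ifP => ha; last case: ifP => hb.
- by elim: r => //= r ->; rewrite ha.
- by elim: r => //= r ->; rewrite ha hb.
- by elim: r => //= r ->; rewrite ha hb.
Qed.

Lemma restr_swap a b w : a != b -> restr b a w = map negb (restr a b w).
Proof.
move=> ab; elim: w => //= v w; rewrite /restr /= => ->.
have [->|va] := eqVneq v a; first by rewrite (negPf ab).
by have [vb|vb] := eqVneq v b.
Qed.

Lemma count_restr a b w : a != b ->
  count_mem false (restr a b w) = count_mem a w /\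
  count_mem true (restr a b w) = count_mem b w.
Proof.
move=> ab; elim: w => //= v w [<- <-]; rewrite /restr /=.
have [->|va] := eqVneq v a; first by rewrite (negPf ab).
by have [vb|vb] := eqVneq v b.
Qed.

Lemma leading_run a w : exists r v, w = nseq r a ++ v /\ ohead v != Some a.
Proof.
elim: w => [|b w [r [v [ew h]]]]; first by exists 0%N, [::].
have [->|ba] := eqVneq b a; first by exists r.+1, v; rewrite ew.
by exists 0%N, (b :: w); split=> //; apply: contra ba => /eqP [->].
Qed.

Lemma run_inj a r s u v : nseq r a ++ u = nseq s a ++ v ->
  ohead u != Some a -> ohead v != Some a -> r = s /\ u = v.
Proof.
elim: r s => [|r IH] [|s] //= e hu hv.
- by rewrite e eqxx in hu.
- by rewrite -e eqxx in hv.
- by case: e => /IH [] // -> ->.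
Qed.
End Restriction.

(** The first letter gives [o], and the first run has length exactly [r] because the second half
    starts with the other letter. *)
Lemma halves_inj (o o' : bool) r r' u u' : (0 < r)%N -> (0 < r')%N ->
  halves o r ++ u = halves o' r' ++ u' -> [/\ o = o', r = r' & u = u'].
Proof.
case: r => // r; case: r' => // r' _ _; rewrite /halves -!catA => e.
have eo : o = o' by case: e.
subst o'; have neq k x : ohead (nseq k.+1 (~~ o) ++ x) != Some o.
  by case: (o).
have [[rr] {}e] := run_inj e (neq _ _) (neq _ _); split=> //; first by rewrite rr.
by move: e; rewrite rr => /(congr1 (drop (size (nseq r'.+1 (~~ o))))); rewrite !drop_size_cat.
Qed.

Lemma rev_halves o r : rev (halves o r) = halves (~~ o) r.
Proof. by rewrite /halves rev_cat !rev_nseq negbK. Qed.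

Lemma map_negb_halves o r : map negb (halves o r) = halves (~~ o) r.
Proof. by rewrite map_cat !map_nseq. Qed.

Section Peeling.
Variables (T : eqType) (a b c : T).
Implicit Types w : seq T.
Hypothesis abc : uniq [:: a; b; c].

Let neqs : (((b == a) = false) * ((c == a) = false) * ((c == b) = false) *
  ((a == b) = false) * ((a == c) = false) * ((b == c) = false))%type.
Proof.
move: abc; rewrite /= !inE !andbT negb_or => /andP[/andP[ab ac] bc].
by rewrite ![b == a]eq_sym ![c == _]eq_sym (negPf ab) (negPf ac) (negPf bc).
Qed.

Lemma head_cases e w : {subset e :: w <= [:: a; b; c]} ->
  {subset w <= [:: a; b; c]} /\ [\/ e = a, e = b | e = c].
Proof.
move=> sub; split; first by move=> x xw; apply: sub; rewrite inE xw orbT.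
have := sub e (mem_head _ _); rewrite !inE => /or3P[] /eqP;
  by [constructor 1|constructor 2|constructor 3].
Qed.

(** A leading [b] or [c] would show at the head of one of the two restrictions. *)
Lemma peel_first w k Y Y' : {subset w <= [:: a; b; c]} ->
  restr a b w = nseq k false ++ Y -> restr a c w = nseq k false ++ Y' ->
  exists2 w', w = nseq k a ++ w' & {subset w' <= [:: a; b; c]}.
Proof.
elim: k w => [|k IH] w; first by exists w.
case: w => [|e w] //= /head_cases [sub [] ->] {e}; rewrite /restr /= ?eqxx ?neqs //.
by case=> h1 [h2]; have [w' -> sub'] := IH w sub h1 h2; exists w'.
Qed.

(** A leading [c] is excluded by the pair [b], [c], and a leading [a] by the pair [a], [c], whose
    restriction does not change when a [b] is removed. *)
Lemma peel_middle w k Y X : {subset w <= [:: a; b; c]} ->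
  restr b c w = nseq k false ++ Y -> restr a c w = true :: X ->
  exists2 w', w = nseq k b ++ w' & {subset w' <= [:: a; b; c]}.
Proof.
elim: k w => [|k IH] w; first by exists w.
case: w => [|e w] //= /head_cases [sub [] ->] {e}; rewrite /restr /= ?eqxx ?neqs //.
by case=> h1 h2; have [w' -> sub'] := IH w sub h1 h2; exists w'.
Qed.
End Peeling.

(* If [C] starts with [a^r b], then the pairs show that [w] starts with [a^r], then
   [b^r], then [c^r]. *)
Lemma peel_triple (T : eqType) (a b c : T) w C :
  uniq [:: a; b; c] -> {subset w <= [:: a; b; c]} ->
  restr a b w = C -> restr a c w = C -> restr b c w = C -> C != [::] ->
  exists o r C' (w' : seq T), [/\ (0 < r)%N, C = halves o r ++ C', {subset w' <= [:: a; b; c]}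
    & [/\ restr a b w' = C', restr a c w' = C' & restr b c w' = C']].
Proof.
(* Reading the triple as [c], [b], [a] negates all three restrictions, so [C] may be assumed to
   start with its first letter. *)
wlog: a b c w C / ohead C = Some false => [H|].
  case: C => [|[] C] //; last by apply: H.
  move=> u3 sub; have /and3P[] := u3; rewrite !inE !negb_or => /andP[ab ac] bc _.
  move=> h1 h2 h3 _.
  have [|||||||o [r [C' [w' [r0 eC sub' [h1' h2' h3']]]]]] :=
    H c b a w (map negb (true :: C)).
  - by [].
  - by rewrite /= !inE negb_or eq_sym bc ![_ == a]eq_sym ac ab.
  - by move=> x /sub; rewrite !inE orbA orbC (orbC (x == a)) orbA orbAC.
  - by rewrite restr_swap // h3.
  - by rewrite restr_swap // h2.
  - by rewrite restr_swap // h1.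
  - by [].
  exists (~~ o), r, (map negb C'), w'; split=> //.
  - by rewrite -(mapK negbK (true :: C)) eC map_cat map_negb_halves.
  - by move=> x /sub'; rewrite !inE orbA orbC (orbC (x == c)) orbA orbAC.
  - rewrite [restr a b w']restr_swap 1?eq_sym // [restr a c w']restr_swap 1?eq_sym //.
    by rewrite [restr b c w']restr_swap 1?eq_sym // h1' h2' h3'.
move=> hC u3 sub hab hac hbc _.
have /and3P[] := u3; rewrite !inE !negb_or => /andP[ab ac] bc _.
have [r [D [eC nD]]] := leading_run false C.
have r0 : (0 < r)%N by case: r eC hC nD => // ->; move=> -> ; rewrite eqxx.
(* If [C] were a run of [false], then [b] would not occur by the pair [a], [b], but would occur [r]
   times by the pair [b], [c]. *)
have [X eD] : exists X, D = true :: X.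
  case: D eC nD => [|[] D] eC //; last by exists D.
  move: (count_restr w ab) (count_restr w bc); rewrite hab hbc eC cats0.
  by rewrite !count_nseq /= => -[_ <-] []; lia.
subst D; have [w1 ew sub1] := peel_first u3 sub (etrans hab eC) (etrans hac eC).
move: hab hac hbc; rewrite ew !restr_cat !restr_nseq !eqxx.
rewrite (negPf ab) (negPf ac) eC => /(congr1 (drop r)) + /(congr1 (drop r)).
rewrite !drop_size_cat ?size_nseq //= => hab hac hbc.
have [w2 ew1 sub2] := peel_middle u3 sub1 hbc hac.
move: hab hac hbc; rewrite ew1 !restr_cat !restr_nseq !eqxx.
rewrite eq_sym (negPf ab) (negPf bc) /= => hab hac /(congr1 (drop r)).
rewrite !drop_size_cat ?size_nseq //= => hbc.
have u3' : uniq [:: c; a; b].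
  by rewrite /= !inE negb_or ![c == _]eq_sym ac bc ab.
have sub2' : {subset w2 <= [:: c; a; b]}.
  by move=> x /sub2; rewrite !inE => /or3P[] ->; rewrite ?orbT.
(* Both restrictions of [w2] to a pair with [c] now equal [nseq r true ++ restr a b w2]; exchanging
   the two letters puts [c] first. *)
have [||w3 ew2 sub3] := @peel_first _ c a b u3' w2 r (map negb (restr a b w2))
  (map negb (restr a b w2)) sub2'.
- by rewrite restr_swap // hac -hab map_cat map_nseq.
- by rewrite restr_swap // hbc -hab map_cat map_nseq.
move: hab hac hbc; rewrite ew2 !restr_cat !restr_nseq !eqxx.
rewrite ![c == _]eq_sym (negPf ac) (negPf bc) /= => hab; rewrite -hab.
move=> /(congr1 (drop r)) + /(congr1 (drop r)).
rewrite !drop_size_cat ?size_nseq //= => hac hbc.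
exists false, r, (restr a b w3), w3; split=> //.
- by rewrite /halves -catA hab.
- by move=> x /sub3; rewrite !inE => /or3P[] ->; rewrite ?orbT.
Qed.

Lemma split_first (T : eqType) (c : T) w : exists u v,
  [/\ w = u ++ v, c \notin u & v = [::] \/ exists v', v = c :: v'].
Proof.
elim: w => [|e w [u [v [ew cu hv]]]]; first by exists [::], [::]; split=> //; left.
have [->|ec] := eqVneq e c; first by exists [::], (c :: w); split=> //; right; exists w.
by exists (e :: u), v; split=> //; rewrite ?ew // inE eq_sym (negPf ec).
Qed.

Lemma restr_notin (T : eqType) (a b : T) w : b \notin w ->
  restr a b w = nseq (count_mem a w) false.
Proof.
elim: w => //= e w IH; rewrite inE negb_or => /andP[be /IH ew].
rewrite /restr /= -/(restr _ _ _) [e == b]eq_sym (negPf be).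
by case: (e == a); rewrite /= -/(restr a b w) ew.
Qed.

(** Let [u] be the part of [w] before the first [c]. The restrictions against [c] show that [u]
    holds equally many [a] and [b], and at least one. A non-empty balanced prefix of
    [halves o r ++ C] covers its first block, so the whole block precedes [c]. *)
Lemma peel_between (T : eqType) (a b c : T) w o r B C :
  uniq [:: a; b; c] -> {subset w <= [:: a; b; c]} -> (0 < r)%N ->
  restr a b w = halves o r ++ C -> restr a c w = B -> restr b c w = B ->
  ohead B = Some false ->
  exists B' (w' : seq T), [/\ B = nseq r false ++ B', {subset w' <= [:: a; b; c]},
    restr a b w' = C, restr a c w' = B' & restr b c w' = B'].
Proof.
move=> u3 sub r0 hab hac hbc hB.
have /and3P[] := u3; rewrite !inE !negb_or => /andP[ab ac] bc _.
have [u [v [ew cu hv]]] := split_first c w.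
have hv' d : d != c -> ohead (restr d c v) != Some false.
  move=> dc; case: hv => [-> //|[v' ->]].
  by rewrite /restr /= eqxx [c == d]eq_sym (negPf dc).
move: hab hac hbc; rewrite ew !restr_cat !(restr_notin _ cu) => hab hac hbc.
have [kk ev] := run_inj (etrans hac (esym hbc)) (hv' _ ac) (hv' _ bc).
set k := count_mem a u in hac kk.
have k0 : (0 < k)%N.
  by case: k kk hac => //= _ hac; move: (hv' _ ac); rewrite hac hB.
have cU d : count_mem d (restr a b u) = k.
  by have [h1 h2] := count_restr u ab; case: d; rewrite ?h1 ?h2 // -kk.
have [x eU] : exists x, restr a b u = halves o r ++ x.
  have [//|[x ex]] := cat_comparable (esym hab).
  exists [::]; rewrite cats0 ex.
  have cx d : (count_mem d x + k = r)%N.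
    by rewrite -(count_halves d o r) ex count_cat cU addnC.
  suff rk : (r <= k)%N.
    have : size x = 0%N.
      rewrite -(count_predC (pred1 true)) (@eq_count _ (predC _) (pred1 false)); last by case.
      by have := cx true; have := cx false; move: rk; rewrite /=; lia.
    by case: x {ex cx} => // _; rewrite cats0.
  have [[y ey]|[y ey]] := cat_comparable (ex : nseq r o ++ nseq r (~~ o) = _ ++ x).
    by rewrite -(cU o) ey count_cat count_nseq /= eqxx mul1n leq_addr.
  have /(congr1 (count_mem (~~ o))) := ey.
  by rewrite count_cat cU count_nseq /=; case: (o) => /=; lia.
have [u1 [u2 [eu eu1 eu2]]] := pmap_split eU.
have ra : count_mem a u1 = r.
  by have [<- _] := count_restr u1 ab; rewrite /restr eu1 count_halves.
have rb : count_mem b u1 = r.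
  by have [_ <-] := count_restr u1 ab; rewrite /restr eu1 count_halves.
move: cu; rewrite eu mem_cat negb_or => /andP[cu1 cu2].
exists (restr a c (u2 ++ v)), (u2 ++ v); split=> //.
- by rewrite restr_cat (restr_notin _ cu2) catA -nseqD -ra -count_cat -eu.
- by move=> e; rewrite mem_cat => h; apply: sub; rewrite ew eu !mem_cat -orbA h orbT.
- rewrite restr_cat {1}/restr eu2; move: hab; rewrite eU -catA.
  by move=> /(congr1 (drop (size (halves o r)))); rewrite !drop_size_cat.
- move: kk; rewrite /k eu !count_cat ra rb => /addnI kk.
  by rewrite !restr_cat !(restr_notin _ cu2) kk ev.
Qed.

Lemma peel_prefix (T : eqType) (a b c : T) w r B B' :
  uniq [:: a; b; c] -> {subset w <= [:: a; b; c]} ->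
  restr a b w = nseq r false ++ B -> restr a c w = nseq r false ++ B' ->
  exists w' : seq T, [/\ {subset w' <= [:: a; b; c]},
    restr a b w' = B, restr a c w' = B' & restr b c w' = restr b c w].
Proof.
move=> u3 sub hab hac; have [w' ew sub'] := peel_first u3 sub hab hac.
have /and3P[] := u3; rewrite !inE !negb_or => /andP[ab ac] bc _.
move: hab hac; rewrite ew !restr_cat !restr_nseq !eqxx (negPf ab) (negPf ac).
move=> /(congr1 (drop r)) + /(congr1 (drop r)).
rewrite !drop_size_cat ?size_nseq // => hab hac.
by exists w'; rewrite -hab -hac.
Qed.

(* [w_i] is the local sequence of path [i] in a regular system of size 4. *)
Lemma local_blocks (A B C : seq bool) (w1 w2 w3 w4 : seq nat) :
  {subset w1 <= [:: 2; 3; 4]} -> {subset w2 <= [:: 1; 3; 4]} ->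
  {subset w3 <= [:: 1; 2; 4]} -> {subset w4 <= [:: 1; 2; 3]} ->
  [/\ restr 2 3 w1 = A, restr 2 4 w1 = A & restr 3 4 w1 = A] ->
  [/\ restr 1 3 w2 = B, restr 1 4 w2 = B & restr 3 4 w2 = A] ->
  [/\ restr 1 2 w3 = C, restr 1 4 w3 = B & restr 2 4 w3 = B] ->
  [/\ restr 1 2 w4 = C, restr 1 3 w4 = C & restr 2 3 w4 = C] ->
  exists ws, [/\ all (fun b => 0 < b.2)%N ws,
    A = xy_word ws, B = xz_word ws & C = yz_word ws].
Proof.
have [n] := ubnP (size B); elim: n A B C w1 w2 w3 w4 => // n IH A B C w1 w2 w3 w4.
move=> Bn s1 s2 s3 s4 [h1 h1' h1''] [h2 h2' h2''] [h3 h3' h3''] [h4 h4' h4''].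
have count_eq (a b : nat) w : a != b ->
    count_mem a w = count_mem false (restr a b w) /\
    count_mem b w = count_mem true (restr a b w).
  by move=> ab; have [-> ->] := count_restr w ab.
have [c1 c2] := @count_eq 1%N 2%N w3 isT; have [c1' _] := @count_eq 1%N 4%N w3 isT.
have [c2' _] := @count_eq 2%N 4%N w3 isT.
have [c3 c4] := @count_eq 3%N 4%N w2 isT; have [_ c3'] := @count_eq 1%N 3%N w2 isT.
have [_ c4'] := @count_eq 1%N 4%N w2 isT.
rewrite ?h3 ?h3' ?h3'' ?h2 ?h2' ?h2'' in c1 c2 c1' c2' c3 c4 c3' c4'.
have size_count (D : seq bool) : size D = (count_mem false D + count_mem true D)%N.
  by elim: D => //= -[] D -> /=; lia.
(* The first letter of [B] tells whether path 2 first meets path 1 or an upper path, hence the kind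
   of the next block. A cd block is read off path 1 and removed from paths 1, 2, 3; an ab block is
   read off path 4 and removed from paths 4, 3, 2. *)
case: B Bn h2 h2' h3' h3'' c1' c2' c3' c4' => [|[] B] Bn h2 h2' h3' h3'' c1' c2' c3' c4'.
- have /eqP : size A = 0%N by rewrite size_count -c3 -c4 c3' c4'.
  have /eqP : size C = 0%N by rewrite size_count -c1 -c2 c1' c2'.
  by rewrite !size_eq0 => /eqP -> /eqP ->; exists [::].
- have A0 : A != [::] by apply/eqP => A0; move: c3; rewrite A0 c3'.
  have [ o [r [A' [w1' [r0 eA s1' h1s]]]]] :=
    @peel_triple _ 2%N 3%N 4%N _ _ isT s1 h1 h1' h1'' A0.
  have s2' : {subset w2 <= [:: 3; 4; 1]}.
    by move=> x /s2; rewrite !inE => /or3P[] ->; rewrite ?orbT.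
  have [|||B' [w2' [eB s2'' k1 k2 k3]]] := @peel_between _ 3%N 4%N 1%N w2 o r
    (map negb (true :: B)) A' isT s2' r0 (etrans h2'' eA).
  + by rewrite restr_swap // h2.
  + by rewrite restr_swap // h2'.
  + by [].
  have s3' : {subset w3 <= [:: 4; 1; 2]}.
    by move=> x /s3; rewrite !inE => /or3P[] ->; rewrite ?orbT.
  have [||w3' [s3'' l1 l2 l3]] := @peel_prefix _ 4%N 1%N 2%N w3 r B' B' isT s3'.
  + by rewrite restr_swap // h3'.
  + by rewrite restr_swap // h3''.
  have eB' : true :: B = nseq r true ++ map negb B'.
    by rewrite -(mapK negbK (true :: B)) eB map_cat map_nseq.
  have [|||||||||ws [pos eA' eB2 eC]] := IH A' (map negb B') C w1' w2' w3' w4.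
  + by move: Bn; rewrite eB' size_cat size_nseq; lia.
  + by [].
  + by move=> x /s2''; rewrite !inE => /or3P[] ->; rewrite ?orbT.
  + by move=> x /s3''; rewrite !inE => /or3P[] ->; rewrite ?orbT.
  + by [].
  + by [].
  + by split=> //; rewrite restr_swap // ?k2 ?k3.
  + by split; rewrite ?l3 // restr_swap // ?l1 ?l2.
  + by [].
  exists ((true, o, r) :: ws); split=> //=; first by rewrite r0.
  + by rewrite eA eA'.
  + by rewrite eB' eB2.
- have C0 : C != [::] by apply/eqP => C0; move: c1; rewrite C0 c1'.
  have [ o [r [C' [w4' [r0 eC s4' h4s]]]]] :=
    @peel_triple _ 1%N 2%N 3%N _ _ isT s4 h4 h4' h4'' C0.
  have [B' [w3' [eB s3' k1 k2 k3]]] :=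
    @peel_between _ 1%N 2%N 4%N _ _ _ _ _ isT s3 r0 (etrans h3 eC) h3' h3'' erefl.
  have [w2' [s2' l1 l2 l3]] :=
    @peel_prefix _ 1%N 3%N 4%N _ _ _ _ isT s2 (etrans h2 eB) (etrans h2' eB).
  have [|||||||||ws [pos eA eB2 eC']] := IH A B' C' w1 w2' w3' w4' => //.
  + by move: Bn; rewrite eB size_cat size_nseq; lia.
  + by rewrite l3.
  exists ((false, o, r) :: ws); split=> //=; first by rewrite r0.
  + by rewrite eB eB2.
  + by rewrite eC eC'.
Qed.

(** In each triple containing it, path [i] is lowest, middle or highest, so its local sequence
    restricts to what [sigma] shows on x, y, on x, z or on y, z. *)
Lemma extension4_blocks sigma W : extension4 sigma W ->
  exists ws, all (fun b => 0 < b.2)%N ws /\ block_code sigma ws.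
Proof.
move=> [e123 e124 e134 e234].
pose l1 e := match e with p12 => Some 2 | p13 => Some 3 | p14 => Some 4 | _ => None end.
pose l2 e := match e with p12 => Some 1 | p23 => Some 3 | p24 => Some 4 | _ => None end.
pose l3 e := match e with p13 => Some 1 | p23 => Some 2 | p34 => Some 4 | _ => None end.
pose l4 e := match e with p14 => Some 1 | p24 => Some 2 | p34 => Some 3 | _ => None end.
have sub l s : (forall e x, l e = Some x -> x \in s) ->
    {subset pmap l W <= (s : seq nat)}.
  move=> ls x; rewrite mem_pmap => /mapP[e _ /esym]; exact: ls.
have [| | | | | | | |ws [pos eA eB eC]] := @local_blocks (pmap pair_xy sigma)
  (pmap pair_xz sigma) (pmap pair_yz sigma) (pmap l1 W) (pmap l2 W) (pmap l3 W) (pmap l4 W).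
1-4: by apply: sub => -[] x //= [<-].
1: split; [rewrite -e123|rewrite -e124|rewrite -e134].
4: split; [rewrite -e123|rewrite -e124|rewrite -e234].
7: split; [rewrite -e123|rewrite -e134|rewrite -e234].
10: split; [rewrite -e124|rewrite -e134|rewrite -e234].
1-12: by rewrite /restr !pmap_pmap; apply: eq_pmap => -[].
by exists ws.
Qed.

(** * Symmetry of signatures and blocks *)

(* Turning the picture upside down replaces path [i] by path [n + 1 - i]. *)
Definition flip_crossing c :=
  match c with cr_x => cr_z | cr_y => cr_y | cr_z => cr_x end.
Definition flip_pair e := match e with p12 => p34 | p13 => p24 | p14 => p14
  | p23 => p23 | p24 => p13 | p34 => p12 end.
(** Lower paths become upper ones, and labels met in increasing order are met in decreasing
    order. *)
Definition flip_block (b : block) : block := (~~ b.1.1, ~~ b.1.2, b.2).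

Lemma flip_crossingK : involutive flip_crossing. Proof. by case. Qed.

Lemma flip_extension4 sigma W : extension4 sigma W ->
  extension4 (map flip_crossing sigma) (map flip_pair W).
Proof.
move=> [e123 e124 e134 e234].
split; [rewrite -e234|rewrite -e134|rewrite -e124|rewrite -e123];
  by rewrite pmap_map; elim: W {e123 e124 e134 e234} => //= -[] W ->.
Qed.

Lemma flip_block_code sigma ws : block_code sigma ws ->
  block_code (map flip_crossing sigma) (map flip_block ws).
Proof.
move=> [exy exz eyz]; split; rewrite pmap_map.
- have -> : xy_word (map flip_block ws) = map negb (yz_word ws).
    elim: (ws) => // -[[[] o] r] w; rewrite /xy_word /yz_word /= => -> //.
    by rewrite map_cat map_negb_halves.
  by rewrite -eyz; elim: (sigma) => //= -[] w ->.
- have -> : xz_word (map flip_block ws) = map negb (xz_word ws).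
    elim: (ws) => // -[[k o] r] w; rewrite /xz_word /= => ->.
    by rewrite map_cat map_nseq.
  by rewrite -exz; elim: (sigma) => //= -[] w ->.
- have -> : yz_word (map flip_block ws) = map negb (xy_word ws).
    elim: (ws) => // -[[[] o] r] w; rewrite /xy_word /yz_word /= => -> //.
    by rewrite map_cat map_negb_halves.
  by rewrite -exy; elim: (sigma) => //= -[] w ->.
Qed.

Lemma count_flip c w : count_mem c (map flip_crossing w) = count_mem (flip_crossing c) w.
Proof. by rewrite count_map; apply: eq_count => -[]; case: c. Qed.

Lemma flip_irreducible sigma : irreducible sigma -> irreducible (map flip_crossing sigma).
Proof.
move=> [s0 irr]; split; first by case: sigma s0 {irr}.
move=> [w1 [w2 [e n1 n2 xy yz]]]; apply: irr.
exists (map flip_crossing w1), (map flip_crossing w2); split.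
- by rewrite -map_cat -e (mapK flip_crossingK).
- by case: w1 n1 {e xy yz}.
- by case: w2 n2 {e xy yz}.
- by rewrite /num_X /num_Y !count_flip; apply: esym yz.
- by rewrite /num_Y /num_Z !count_flip; apply: esym xy.
Qed.

(* The first alternative of condition (2); turning the picture upside down gives
   the second one, with [p] and [q] exchanged. *)
Definition forward_split (sigma : seq crossing) :=
  exists alpha beta gamma P Q,
    [/\ sigma = alpha ++ beta ++ gamma,
        (num_X alpha, num_Y alpha, num_Z alpha) = (P, P, 0%N),
        (num_X beta, num_Y beta, num_Z beta) = (Q, 0%N, P),
        (num_X gamma, num_Y gamma, num_Z gamma) = (0%N, Q, Q)
      & ~ (P = 0%N /\ Q = 0%N)].

Lemma forward_split_flip sigma : forward_split (map flip_crossing sigma) <->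
  exists alpha beta gamma P Q,
    [/\ sigma = gamma ++ beta ++ alpha,
        (num_X alpha, num_Y alpha, num_Z alpha) = (P, P, 0%N),
        (num_X beta, num_Y beta, num_Z beta) = (Q, 0%N, P),
        (num_X gamma, num_Y gamma, num_Z gamma) = (0%N, Q, Q)
      & ~ (P = 0%N /\ Q = 0%N)].
Proof.
split=> -[alpha [beta [gamma [P [Q [e [a1 a2 a3] [b1 b2 b3] [c1 c2 c3] PQ]]]]]].
- exists (map flip_crossing gamma), (map flip_crossing beta), (map flip_crossing alpha), Q, P.
  split; last by case=> ? ?; apply: PQ.
  + by rewrite -!map_cat -e (mapK flip_crossingK).
  1-3: by rewrite /num_X /num_Y /num_Z !count_flip; congr (_, _, _).
- exists (map flip_crossing gamma), (map flip_crossing beta), (map flip_crossing alpha), Q, P.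
  split; last by case=> ? ?; apply: PQ.
  + by rewrite -!map_cat -e.
  1-3: by rewrite /num_X /num_Y /num_Z !count_flip; congr (_, _, _).
Qed.

(** The first block selects the alternative of (2): a leading cd block becomes an ab block when the
    picture is turned upside down. *)
Lemma extension4_forward sigma W ws : extension4 sigma W -> irreducible sigma ->
  all (fun b => 0 < b.2)%N ws -> block_code sigma ws ->
  forward_split sigma \/ forward_split (map flip_crossing sigma).
Proof.
move=> ext irr pos code.
case: ws pos code => [|[[[] o] r] ws] pos code.
- case: irr => + _; case: code; case: sigma {ext} => [|[] s] //=.
- right; apply: (condition2_ab (ws := flip_block (true, o, r) :: map flip_block ws) _
    (flip_block_code code) _ erefl (flip_extension4 ext)).
    by rewrite -map_cons all_map.
  exact: flip_irreducible.
- by left; apply: condition2_ab pos code irr _ _ _ erefl _ ext.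
Qed.

(** * Restrictions of the sequences prescribed by omega *)

Definition local_word i n (ws : seq block) : seq nat :=
  flatten [seq (let s := if b.1.1 then iota i.+1 (n - i) else iota 1 i.-1 in
                copies b.2 (if b.1.2 then rev s else s)) | b <- ws].

Lemma restr_copies j k r s :
  restr j k (copies r s) = flatten [seq nseq r b | b <- restr j k s].
Proof.
elim: s => //= e s IH; rewrite /copies /= restr_cat restr_nseq -/(copies r s) IH.
rewrite [in RHS]/restr /=; case: (e == j) => //=.
by case: (e == k).
Qed.

Lemma restr_rev (T : eqType) (j k : T) s : restr j k (rev s) = rev (restr j k s).
Proof.
elim: s => //= e s IH; rewrite rev_cons -cats1 restr_cat IH /restr /=.
by do 2 (case: ifP => _; rewrite ?rev_cons ?cats1 ?cats0 //=).
Qed.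

Lemma restr_iota j k m n : (j < k)%N -> restr j k (iota m n) =
  nseq (m <= j < m + n)%N false ++ nseq (m <= k < m + n)%N true.
Proof.
move=> jk; elim: n m => [|n IH] m.
  have out i : (m <= i < m + 0)%N = false by lia.
  by rewrite !out.
rewrite [iota _ _]/= -cat1s restr_cat IH /restr /= addSnnS.
have [mj|mj] := eqVneq m j.
  have [-> -> -> ->] : [/\ (m < j)%N = false, (m <= j < m + n.+1)%N = true,
    (m < k)%N = true & (m <= k)%N = true] by move: jk; rewrite mj; clear; split; lia.
  by [].
have [mk|mk] := eqVneq m k.
  have [-> -> -> ->] : [/\ (m < j)%N = false, (m <= j)%N = false,
    (m < k)%N = false & (m <= k < m + n.+1)%N = true].
    by move: jk; rewrite mk; clear; split; lia.
  by [].
by rewrite /= ![(m < _)%N]ltn_neqAle mj mk.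
Qed.

Lemma restr_local_word j k i n ws : (0 < j)%N -> (j < k <= n)%N ->
  restr j k (local_word i n ws) =
  flatten [seq (let s := if b.1.1 then nseq (i < j)%N false ++ nseq (i < k)%N true
                         else nseq (j < i)%N false ++ nseq (k < i)%N true in
     flatten [seq nseq b.2 c | c <- if b.1.2 then rev s else s]) | b <- ws].
Proof.
move=> j0 /andP[jk kn]; elim: ws => //= -[[q o] r] ws IH.
rewrite /local_word /= restr_cat -/(local_word i n ws) IH restr_copies; congr (_ ++ _).
have eq_iota : restr j k (if q then iota i.+1 (n - i) else iota 1 i.-1) =
    if q then nseq (i < j)%N false ++ nseq (i < k)%N true
    else nseq (j < i)%N false ++ nseq (k < i)%N true.
  by case: q; rewrite restr_iota //; congr (nseq _ _ ++ nseq _ _); congr nat_of_bool;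
    move: j0 jk kn; clear; lia.
by case: o; rewrite ?restr_rev eq_iota; case: q eq_iota.
Qed.

(** Path [i] has the largest label of the three: cd blocks show neither [j] nor [k], and ab blocks
    show both. The next two lemmas treat the middle and the smallest label. *)
Lemma restr_local_low j k i n ws : (0 < j)%N -> (j < k)%N -> (k < i <= n)%N ->
  restr j k (local_word i n ws) = yz_word ws.
Proof.
move=> j0 jk /andP[ki kn]; rewrite restr_local_word //; last by lia.
have -> : (i < j)%N = false by lia.
have -> : (i < k)%N = false by lia.
rewrite (ltn_trans jk ki) ki.
by congr flatten; apply: eq_map => -[[[] []] r] //=; rewrite cats0.
Qed.

Lemma restr_local_mid j k i n ws : (0 < j)%N -> (j < i)%N -> (i < k <= n)%N ->
  restr j k (local_word i n ws) = xz_word ws.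
Proof.
move=> j0 ji /andP[ik kn]; rewrite restr_local_word //; last by lia.
have -> : (i < j)%N = false by lia.
have -> : (k < i)%N = false by lia.
rewrite ji ik.
by congr flatten; apply: eq_map => -[[[] []] r] //=; rewrite cats0.
Qed.

Lemma restr_local_high j k i n ws : (i < j)%N -> (j < k <= n)%N ->
  restr j k (local_word i n ws) = xy_word ws.
Proof.
move=> ij /andP[jk kn]; rewrite restr_local_word //; [|by lia|by lia].
have -> : (j < i)%N = false by lia.
have -> : (k < i)%N = false by lia.
rewrite ij (ltn_trans ij jk).
by congr flatten; apply: eq_map => -[[[] []] r] //=; rewrite cats0.
Qed.

(** The last disjunct covers the degenerate case [n < i], where [iota 1 i.-1] may run past [n]. *)
Lemma mem_local_word i n ws v :
  v \in local_word i n ws -> (0 < v <= n)%N && (v != i) || ((n < i)%N && (v < i)%N).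
Proof.
move=> /flattenP [s /mapP[[[q o] r] _ ->]] /= /flattenP [s' /mapP[x + ->]].
rewrite mem_nseq => h /andP[_ /eqP ->] {v}.
have {h} : x \in (if q then iota i.+1 (n - i) else iota 1 i.-1).
  by case: o h; rewrite ?mem_rev.
by case: q; rewrite mem_iota; lia.
Qed.

(** * Words of blocks and their codes *)

Definition letters_of (b : block) : seq letter :=
  let: (k, o, r) := b in
  let: (l, m) := if k then (lc, ld) else (la, lb) in
  if o then nseq r m ++ nseq r l else nseq r l ++ nseq r m.

Lemma letters_of_block b : (0 < b.2)%N -> B_abcd (letters_of b).
Proof.
case: b => [[[] o] r] /= r0; [right|left]; exists r; split=> //;
by case: o; [right|left].
Qed.

Lemma block_letters_of u : B_abcd u -> exists b, (0 < b.2)%N /\ u = letters_of b.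
Proof.
case=> -[r [r0 [->|->]]].
- by exists (false, false, r).
- by exists (false, true, r).
- by exists (true, false, r).
- by exists (true, true, r).
Qed.

Lemma phi_local_word i n ws : all (fun b => 0 < b.2)%N ws ->
  phi i n (flatten (map letters_of ws)) = local_word i n ws.
Proof.
move=> pos; rewrite phi_flatten; last first.
  by move=> u /mapP[b bw ->]; apply: letters_of_block (allP pos _ bw).
rewrite -map_comp; congr flatten; apply/eq_in_map => -[[k o] r] /(allP pos) /= r0.
have [e1 e2 e3 e4] := phi_blockE i n r0.
by case: k o => [] [] /=; rewrite ?e1 ?e2 ?e3 ?e4.
Qed.

Lemma W_abcd_blocks omega : W_abcd omega -> exists ws,
  omega = flatten (map letters_of ws) /\ all (fun b => 0 < b.2)%N ws.
Proof.
move=> [[us [Bu ->]] _].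
suff [ws [-> pos]] : exists ws, us = map letters_of ws /\ all (fun b => 0 < b.2)%N ws.
  by exists ws.
elim: us Bu => [|u us IH] Bu; first by exists [::].
have [b [b0 ->]] := block_letters_of (Bu u (mem_head _ _)).
have [|ws [-> pos]] := IH; first by move=> v vu; apply: Bu; rewrite inE vu orbT.
by exists (b :: ws); rewrite /= b0.
Qed.

Lemma blocks_W_abcd ws : all (fun b => 0 < b.2)%N ws ->
  (0 < ab_sum ws)%N -> (0 < cd_sum ws)%N -> W_abcd (flatten (map letters_of ws)).
Proof.
move=> pos ab cd; split.
  exists (map letters_of ws); split=> // u /mapP[b bw ->].
  by apply: letters_of_block (allP pos _ bw).
have [ws1 [ o1 [r1 [ws2 [e1 h1]]]]] := @ab_sum_block ws 1 ab.
have [ws3 [ o3 [r3 [ws4 [e3 h3]]]]] := @cd_sum_block ws 1 cd.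
have ina : la \in flatten (map letters_of ws).
  apply/flattenP; exists (letters_of (false, o1, r1)).
    by apply: map_f; rewrite e1 mem_cat mem_head orbT.
  have r0 : (0 < r1)%N by move: h1; clear; lia.
  by rewrite /=; case: o1 {e1}; rewrite mem_cat !mem_nseq r0 !eqxx ?orbT.
have inc : lc \in flatten (map letters_of ws).
  apply/flattenP; exists (letters_of (true, o3, r3)).
    by apply: map_f; rewrite e3 mem_cat mem_head orbT.
  have r0 : (0 < r3)%N by move: h3; clear; lia.
  by rewrite /=; case: o3 {e3}; rewrite mem_cat !mem_nseq r0 !eqxx ?orbT.
case=> -[us [Bu eus]]; [move: inc|move: ina]; rewrite eus => /flattenP [u /Bu];
  by move=> [r [_ [->|->]]]; rewrite mem_cat !mem_nseq /= !andbF.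
Qed.

(** * The word of an extension *)

(* In the sweep of path [i], it crosses each lower path [q] times and each upper
   path [p] times, in the order of the middle part [ws] of [omega]. *)
Definition sweep1 v :=
  match v with 2 => Some p12 | 3 => Some p13 | 4 => Some p14 | _ => None end.
Definition sweep2 v :=
  match v with 1 => Some p12 | 3 => Some p23 | 4 => Some p24 | _ => None end.
Definition sweep3 v :=
  match v with 1 => Some p13 | 2 => Some p23 | 4 => Some p34 | _ => None end.
Definition sweep4 v :=
  match v with 1 => Some p14 | 2 => Some p24 | 3 => Some p34 | _ => None end.

Definition sweeps ws :=
  pmap sweep1 (local_word 1 4 ws) ++ pmap sweep2 (local_word 2 4 ws) ++
  pmap sweep3 (local_word 3 4 ws) ++ pmap sweep4 (local_word 4 4 ws).

(** Within a triple, the sweep of its lowest path yields [alpha], that of the middle one [beta],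
    that of the highest one [gamma], and the sweep of the fourth path nothing. Each part lacks one
    letter, so its restriction to the other two determines it. *)
Lemma extension4_sweeps alpha beta gamma ws :
  num_Z alpha = 0%N -> num_Y beta = 0%N -> num_X gamma = 0%N ->
  pmap pair_xy alpha = xy_word ws -> pmap pair_xz beta = xz_word ws ->
  pmap pair_yz gamma = yz_word ws ->
  extension4 (alpha ++ beta ++ gamma) (sweeps ws).
Proof.
move=> za yb xc exy exz eyz.
have ea : alpha = map (fun b : bool => if b then cr_y else cr_x) (xy_word ws).
  by rewrite -exy; elim: alpha za {exy} => //= -[] w IH //= /IH {1}->.
have eb : beta = map (fun b : bool => if b then cr_z else cr_x) (xz_word ws).
  by rewrite -exz; elim: beta yb {exz} => //= -[] w IH //= /IH {1}->.
have ec : gamma = map (fun b : bool => if b then cr_z else cr_y) (yz_word ws).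
  by rewrite -eyz; elim: gamma xc {eyz} => //= -[] w IH //= /IH {1}->.
have map_restr (f : bool -> crossing) j k w (g : nat -> option crossing) :
    (forall e, g e = if e == j then Some (f false)
                     else if e == k then Some (f true) else None) ->
    pmap g w = map f (restr j k w).
  by move=> gE; elim: w => //= e w ->; rewrite gE /restr /=; do 2 case: ifP => //.
have pmap_nil (g : nat -> option crossing) w : (forall e, g e = None) -> pmap g w = [::].
  by move=> gE; elim: w => //= e w ->; rewrite gE.
have cmp5 (P : nat -> Prop) : P 0 -> P 1 -> P 2 -> P 3 -> P 4 ->
    (forall v, P v.+4.+1) -> forall v, P v.
  by move=> ? ? ? ? ? ? [|[|[|[|[|v]]]]].
have [r1 r2] : (restr 2 3 (local_word 1 4 ws) = xy_word ws) /\
  (restr 2 4 (local_word 1 4 ws) = xy_word ws) by rewrite !restr_local_high.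
have r3 : restr 3 4 (local_word 1 4 ws) = xy_word ws by rewrite !restr_local_high.
have r4 : restr 3 4 (local_word 2 4 ws) = xy_word ws by rewrite !restr_local_high.
have r5 : restr 1 3 (local_word 2 4 ws) = xz_word ws by rewrite !restr_local_mid.
have r6 : restr 1 4 (local_word 2 4 ws) = xz_word ws by rewrite !restr_local_mid.
have r7 : restr 1 4 (local_word 3 4 ws) = xz_word ws by rewrite !restr_local_mid.
have r8 : restr 2 4 (local_word 3 4 ws) = xz_word ws by rewrite !restr_local_mid.
have r9 : restr 1 2 (local_word 3 4 ws) = yz_word ws by rewrite !restr_local_low.
have r10 : restr 1 2 (local_word 4 4 ws) = yz_word ws by rewrite !restr_local_low.
have r11 : restr 1 3 (local_word 4 4 ws) = yz_word ws by rewrite !restr_local_low.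
have r12 : restr 2 3 (local_word 4 4 ws) = yz_word ws by rewrite !restr_local_low.
rewrite /sweeps ea eb ec; split; rewrite !pmap_cat !pmap_pmap.
- rewrite -{1}r1 -r5 -r9 [X in _ ++ _ ++ _ ++ X]pmap_nil; last by apply: cmp5.
  by rewrite cats0; congr (_ ++ (_ ++ _)); apply: map_restr; apply: cmp5.
- rewrite -{1}r2 -r6 -r10 [X in _ ++ _ ++ X ++ _]pmap_nil; last by apply: cmp5.
  by rewrite cat0s; congr (_ ++ (_ ++ _)); apply: map_restr; apply: cmp5.
- rewrite -{1}r3 -r7 -r11 [X in _ ++ X ++ _ ++ _]pmap_nil; last by apply: cmp5.
  by rewrite cat0s; congr (_ ++ (_ ++ _)); apply: map_restr; apply: cmp5.
- rewrite -{1}r4 -r8 -r12 [X in X ++ _ ++ _ ++ _]pmap_nil; last by apply: cmp5.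
  by rewrite cat0s; congr (_ ++ (_ ++ _)); apply: map_restr; apply: cmp5.
Qed.

(** Extracts the middle part of omega. On y, z the word [sigma] starts with y^P z^P, and on x, y it
    ends with x^Q y^Q; together with its restriction to x, z this shows that [ws] starts with a^P
    b^P and ends with c^Q d^Q, and [ws'] is what remains. If P or Q is 0, nothing is removed on that
    side. *)
Lemma forward_blocks sigma ws : all (fun b => 0 < b.2)%N ws -> block_code sigma ws ->
  forall alpha beta gamma P Q, sigma = alpha ++ beta ++ gamma ->
  (num_X alpha, num_Y alpha, num_Z alpha) = (P, P, 0%N) ->
  (num_X beta, num_Y beta, num_Z beta) = (Q, 0%N, P) ->
  (num_X gamma, num_Y gamma, num_Z gamma) = (0%N, Q, Q) ->
  exists ws', [/\ pmap pair_xy alpha = xy_word ws', pmap pair_xz beta = xz_word ws'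
    & pmap pair_yz gamma = yz_word ws'].
Proof.
move=> pos [exy exz eyz] alpha beta gamma P Q e [aX aY aZ] [bX bY bZ] [cX cY cZ].
have axz : pmap pair_xz alpha = nseq P false.
  by rewrite -aX; elim: alpha aZ {e aX aY} => //= -[] w IH //= /IH {1}->.
have ayz : pmap pair_yz alpha = nseq P false.
  by rewrite -aY; elim: alpha aZ {e aX aY axz} => //= -[] w IH //= /IH {1}->.
have bxy : pmap pair_xy beta = nseq Q false.
  by rewrite -bX; elim: beta bY {e bX bZ} => //= -[] w IH //= /IH {1}->.
have byz : pmap pair_yz beta = nseq P true.
  by rewrite -bZ; elim: beta bY {e bX bZ bxy} => //= -[] w IH //= /IH {1}->.
have cxy : pmap pair_xy gamma = nseq Q true.
  by rewrite -cY; elim: gamma cX {e cY cZ} => //= -[] w IH //= /IH {1}->.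
have cxz : pmap pair_xz gamma = nseq Q true.
  by rewrite -cZ; elim: gamma cX {e cY cZ cxy} => //= -[] w IH //= /IH {1}->.
move: exy exz eyz; rewrite e !pmap_cat axz ayz bxy byz cxy cxz.
move: (pmap pair_xy alpha) (pmap pair_xz beta) (pmap pair_yz gamma) => A B C.
move=> exy exz eyz {e aX aY aZ bX bY bZ cX cY cZ axz ayz bxy byz cxy cxz}.
have [ws1 [pos1 exy1 exz1 eyz1]] : exists ws1, [/\ all (fun b => 0 < b.2)%N ws1,
    A ++ halves false Q = xy_word ws1, B ++ nseq Q true = xz_word ws1
    & C = yz_word ws1].
  case: P exz eyz => [|P] exz eyz; first by exists ws.
  case: ws pos exy exz eyz => [|[[k o] r] ws1] //= /andP[r0 pos1] exy exz eyz.
  case: k exy exz eyz => exy exz eyz; first by case: r r0 exz {exy eyz}.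
  have [eo er ec] : [/\ false = o, P.+1 = r & C = yz_word ws1].
    by apply: halves_inj => //; rewrite /halves -catA.
  exists ws1; split=> //.
  by move: exz; rewrite /xz_word /= -er => /(congr1 (drop P.+1));
    rewrite /= !drop_size_cat ?size_nseq.
have [ws' [exy2 exz2 eyz2]] : exists ws', [/\ A = xy_word ws', B = xz_word ws'
    & C = yz_word ws'].
  case: Q exy1 exz1 {exy exz eyz} => [|Q] exy1 exz1.
    by exists ws1; rewrite -exy1 -exz1 !cats0.
  case/lastP: ws1 pos1 exy1 exz1 eyz1 => [|ws' [[k o] r]].
    by move=> _ _ /(congr1 size); rewrite size_cat /=; lia.
  rewrite all_rcons => /andP[r0 pos2]; rewrite /= in r0.
  have ez : xz_word [:: (k, o, r)] = nseq r k by rewrite /xz_word /= cats0.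
  have ey : xy_word [:: (true, o, r)] = halves o r by rewrite /xy_word /= cats0.
  rewrite -cats1 xy_word_cat xz_word_cat yz_word_cat ez.
  case: k ez => ez exy1 exz1 eyz1; last first.
    move/(congr1 rev): exz1; rewrite !rev_cat !rev_nseq.
    by case: r r0 {exy1 eyz1 ez ey} => // r _ /=.
  move: exy1; rewrite ey => /(congr1 rev).
  rewrite rev_cat rev_halves rev_cat rev_halves.
  move=> /(halves_inj (ltn0Sn _) r0) [_ er /(can_inj revK) eA].
  exists ws'; split=> //; last by rewrite eyz1 cats0.
  by move/(congr1 rev): exz1; rewrite !rev_cat !rev_nseq -er => /(congr1 (drop Q.+1));
    rewrite !drop_size_cat ?size_nseq // => /(can_inj revK).
by exists ws'.
Qed.

Lemma forward_extension4 sigma ws : all (fun b => 0 < b.2)%N ws ->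
  block_code sigma ws -> forward_split sigma -> exists W, extension4 sigma W.
Proof.
move=> pos code [alpha [beta [gamma [P [Q [e a b c _]]]]]].
have [ws' [exy exz eyz]] := forward_blocks pos code e a b c.
exists (sweeps ws'); rewrite e; apply: extension4_sweeps => //.
- by case: a.
- by case: b.
- by case: c.
Qed.

Lemma condition2_extension4 sigma ws : all (fun b => 0 < b.2)%N ws ->
  block_code sigma ws ->
  forward_split sigma \/ forward_split (map flip_crossing sigma) ->
  exists W, extension4 sigma W.
Proof.
move=> pos code [fs|fs]; first exact: forward_extension4 pos code fs.
have [|W ext] := forward_extension4 (ws := map flip_block ws) _ (flip_block_code code) fs.
  by rewrite all_map.
exists (map flip_pair W).
by rewrite -[sigma](mapK flip_crossingK); apply: flip_extension4.
Qed.

(** * Heights along a word of crossings *)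

Definition ends4 (e : pair4) : nat * nat := match e with
  p12 => (0, 1) | p13 => (0, 2) | p14 => (0, 3)
  | p23 => (1, 2) | p24 => (1, 3) | p34 => (2, 3) end%N.

(* When a pair crosses, the third path is on the same side of both. *)
Definition realizable (sigma : seq crossing) := forall u c v, sigma = u ++ c :: v ->
  match c with
  | cr_x => odd (count_mem cr_y u) = odd (count_mem cr_z u)
  | cr_y => odd (count_mem cr_x u) = ~~ odd (count_mem cr_z u)
  | cr_z => odd (count_mem cr_x u) = odd (count_mem cr_y u)
  end.

Definition swap4 (e : pair4) (k : nat) : nat :=
  if k == (ends4 e).1 then (ends4 e).2 else if k == (ends4 e).2 then (ends4 e).1 else k.

(* The position, counted from the bottom, of the path which started at position
   [k], after the crossings listed in [W]. *)
Definition place (W : seq pair4) (k : nat) : nat := foldr swap4 k W.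

Lemma place_rcons W e k : place (rcons W e) k = place W (swap4 e k).
Proof. by rewrite /place foldr_rcons. Qed.

Lemma swap4K e : involutive (swap4 e).
Proof.
move=> k; rewrite /swap4; case: (eqVneq k (ends4 e).1) => [->|k1].
  by rewrite eqxx; case: e.
case: (eqVneq k (ends4 e).2) => [->|k2]; first by rewrite eqxx; case: e k1.
by rewrite (negPf k1) (negPf k2).
Qed.

Lemma place_inj W : injective (place W).
Proof. by elim: W => [|e W IH] // a b /(inv_inj (@swap4K e)) /IH. Qed.

(** Induction along [W]. When a pair crosses, realizability in the two triples containing it puts
    each other path on one side of both, so the exchange of heights changes the order of that pair
    alone. *)
Lemma place_lt sigma W u v e : extension4 sigma W -> realizable sigma -> W = u ++ v ->
  (place u (ends4 e).1 < place u (ends4 e).2)%N = ~~ odd (count_mem e u).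
Proof.
move=> [h123 h124 h134 h234] real.
elim/last_ind: u v e => [|u d IH] v e eW; first by case: e.
rewrite cat_rcons in eW; have {}IH e' := IH _ e' eW.
have IHr e' : (place u (ends4 e').2 < place u (ends4 e').1)%N = odd (count_mem e' u).
  rewrite ltnNge leq_eqVlt IH negb_or negbK.
  case: eqVneq => // /place_inj; by case: (e').
have third (f : pair4 -> option crossing) g : pmap f W = sigma ->
    (forall e' c, (f e' == Some c) = (e' == g c)) ->
    forall c, W = u ++ g c :: v -> match c with
      | cr_x => odd (count_mem (g cr_y) u) = odd (count_mem (g cr_z) u)
      | cr_y => odd (count_mem (g cr_x) u) = ~~ odd (count_mem (g cr_z) u)
      | cr_z => odd (count_mem (g cr_x) u) = odd (count_mem (g cr_y) u)
      end.
  move=> fW fg c e'; have /eqP fgc : f (g c) == Some c by rewrite fg.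
  have cnt c' : count_mem c' (pmap f u) = count_mem (g c') u.
    by apply: count_pmap => e''; apply: fg.
  have := real (pmap f u) c (pmap f v); rewrite -!cnt; apply.
  by rewrite -fW e' pmap_cat /= fgc.
have t123 := third _ (fun c => match c with cr_x => p12 | cr_y => p13 | cr_z => p23 end)
  h123 ltac:(by do 2 case).
have t124 := third _ (fun c => match c with cr_x => p12 | cr_y => p14 | cr_z => p24 end)
  h124 ltac:(by do 2 case).
have t134 := third _ (fun c => match c with cr_x => p13 | cr_y => p14 | cr_z => p34 end)
  h134 ltac:(by do 2 case).
have t234 := third _ (fun c => match c with cr_x => p23 | cr_y => p24 | cr_z => p34 end)
  h234 ltac:(by do 2 case).
rewrite !place_rcons -cats1 count_cat oddD /= addn0 oddb negb_add.
move: (IH p12) (IH p13) (IH p14) (IH p23) (IH p24) (IH p34).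
move: (IHr p12) (IHr p13) (IHr p14) (IHr p23) (IHr p24) (IHr p34) => /=.
move=> s12 s13 s14 s23 s24 s34 r12 r13 r14 r23 r24 r34.
case: d eW => eW;
  [have := (t123 cr_x eW, t124 cr_x eW)|have := (t123 cr_y eW, t134 cr_x eW)
  |have := (t124 cr_y eW, t134 cr_y eW)|have := (t123 cr_z eW, t234 cr_x eW)
  |have := (t124 cr_z eW, t234 cr_y eW)|have := (t134 cr_z eW, t234 cr_z eW)];
  move=> /= -[e1 e2]; case: e;
  rewrite /swap4 /= ?s12 ?s13 ?s14 ?s23 ?s24 ?s34 ?r12 ?r13 ?r14 ?r23 ?r24 ?r34;
  rewrite ?e1 ?e2 ?negbK //; move: e1 e2; do !case: (odd _) => //=.
Qed.

(** * Recorded events *)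

Local Open Scope classical_set_scope.
Local Open Scope ring_scope.

Section Records.
Variable R : realType.

Lemma records_uniq (A : eqType) (E E' : R -> A -> Prop) w w' :
  (forall t v, E t v <-> E' t v) -> records E w -> records E' w' -> w = w'.
Proof.
move=> EE [ev [s h ->]] [ev' [s' h' ->]]; congr map.
apply: (irr_sorted_eq (leT := fun e1 e2 : R * A => e1.1 < e2.1)) => //.
- by move=> e1 e2 e3; apply: lt_trans.
- by move=> [t v]; apply/idP/idP => [/h /EE /h'|/h' /EE /h].
Qed.

Lemma eq_records (A : eqType) (E E' : R -> A -> Prop) w :
  (forall t v, E t v <-> E' t v) -> records E w -> records E' w.
Proof.
move=> EE [ev [s h ->]]; exists ev; split=> // t v.
by split=> [/h /EE|/EE /h].
Qed.

(** Disjoint pairs of paths may cross simultaneously, so the list is only weakly sorted; it suffices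
    that [f] keeps at most one event at each abscissa. *)
Lemma records_pmap_weak (A B : eqType) (ev : seq (R * A)) (f : A -> option B) :
  sorted (fun e1 e2 => e1.1 <= e2.1) ev -> uniq ev ->
  (forall t a a', (t, a) \in ev -> (t, a') \in ev -> f a -> f a' -> a = a') ->
  records (fun t b => exists2 a, (t, a) \in ev & f a = Some b) (pmap f (map snd ev)).
Proof.
set g := fun e : R * A => omap (pair e.1) (f e.2) => so un sim.
exists (pmap g ev); split.
- rewrite sorted_pairwise; last by move=> e1 e2 e3; apply: lt_trans.
  move: so; rewrite sorted_pairwise; last by move=> e1 e2 e3; apply: le_trans.
  elim: ev un sim => //= e ev IH /andP[ne un] sim /andP[/allP le pw].
  have {}IH : pairwise (fun e1 e2 : R * B => e1.1 < e2.1) (pmap g ev).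
    apply: IH => // t a a' h h'; have sub x : x \in ev -> x \in e :: ev.
      by move=> xev; rewrite inE xev orbT.
    exact: sim (sub _ h) (sub _ h').
  rewrite [g e]/g; case fe: (f e.2) => [b|] //=; rewrite IH andbT.
  apply/allP => -[t b']; rewrite mem_pmap => /mapP [[t' a'] e' ].
  rewrite /g /=; case fa: (f a') => [b''|] //= [-> _].
  have := le _ e'; rewrite /= le_eqVlt => /orP[/eqP te|//].
  case: e te ne sim fe {le} => t'' a /= te ne sim fe; subst t'.
  have aa : a = a'.
    by apply: (sim t''); rewrite ?mem_head ?inE ?e' ?orbT ?fe ?fa.
  by rewrite aa e' in ne.
- move=> t b; rewrite mem_pmap; split.
    move=> /mapP[[t' a] h]; rewrite /g /=; case fa: (f a) => [b'|] //= [-> ->].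
    by exists a.
  by move=> [a h fa]; apply/mapP; exists (t, a) => //; rewrite /g /= fa.
- by elim: ev {so un sim} => //= e ev ->; rewrite /g; case: (f e.2).
Qed.

Lemma records_inj (A : eqType) (E : R -> A -> Prop) w t a a' :
  records E w -> E t a -> E t a' -> a = a'.
Proof.
move=> [ev [so h _]] /h + /h.
have : pairwise (fun e1 e2 : R * A => e1.1 < e2.1) ev.
  by rewrite -sorted_pairwise // => e1 e2 e3; apply: lt_trans.
elim: ev {so h} => //= e ev IH /andP[/allP lt pw]; rewrite !inE.
move=> /orP[/eqP ea|h] /orP[/eqP ea'|h'].
- by move: ea'; rewrite -ea => -[].
- by have := lt _ h'; rewrite -ea /= ltxx.
- by have := lt _ h; rewrite -ea' /= ltxx.
- exact: IH.
Qed.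

Lemma records_pmap (A B : eqType) (E : R -> A -> Prop) (f : A -> option B) w :
  records E w -> records (fun t b => exists2 a, E t a & f a = Some b) (pmap f w).
Proof.
move=> rec; have [ev [so h ->]] := rec.
apply: eq_records (records_pmap_weak (ev := ev) (f := f) _ _ _).
- by move=> t b; split=> -[a /h]; exists a.
- by apply: sub_sorted so => e1 e2; apply: ltW.
- apply: sorted_uniq so; first by move=> e1 e2 e3; apply: lt_trans.
  by move=> e; apply: ltxx.
- by move=> t a a' /h h1 /h h2 _ _; apply: records_inj rec h1 h2.
Qed.

Lemma finite_events (J : finType) (A : eqType) (P : pred J) (lab : J -> A)
    (M : J -> R -> Prop) : (forall j, P j -> finite_set [set t | M j t]) ->
  exists ev : seq (R * A), [/\ sorted (fun e1 e2 => e1.1 <= e2.1) ev, uniq ev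
    & forall t v, (t, v) \in ev <-> exists j, [/\ v = lab j, P j & M j t]].
Proof.
move=> fin; have [s sP] : exists s : J -> seq R,
    forall j, forall t, t \in s j <-> P j /\ M j t.
  apply: (@fin_all_exists _ _ (fun j (s : seq R) => forall t, t \in s <-> P j /\ M j t)).
  move=> j; case Pj: (P j); last by exists [::] => t; split=> // -[].
  have /finite_seqP [s es] := fin j Pj; exists s => t.
  have -> : M j t = [set t | M j t] t by [].
  by rewrite es /=; split=> // -[].
set ev := flatten [seq [seq (t, lab j) | t <- s j] | j <- enum J].
have mem_ev t v : (t, v) \in ev <-> exists j, [/\ v = lab j, P j & M j t].
  split.
    move=> /flattenP[l /mapP[j _ ->]] /mapP[t' /sP [Pj Mj] [-> ->]].
    by exists j.
  move=> [j [-> Pj Mj]]; apply/flattenP; exists [seq (t, lab j) | t <- s j].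
    by apply: map_f; rewrite mem_enum.
  by apply: map_f; apply/sP.
exists (sort (fun e1 e2 : R * A => e1.1 <= e2.1) (undup ev)); split.
- by apply: sort_sorted => e1 e2; apply: le_total.
- by rewrite sort_uniq undup_uniq.
- by move=> t v; rewrite mem_sort mem_undup.
Qed.
End Records.

(** * Local sequences and tableaux of systems *)

Definition select (T : Type) (a b c : T) (i : 'I_3) : T :=
  match val i with 0%N => a | 1%N => b | _ => c end.

(** Distinct first letters would show in the restriction to these two letters. The partner given to
    each label covers the case where one word ends before the other. *)
Lemma eq_from_restr (D : pred nat) (s s' : seq nat) :
  (forall v, v \in s -> D v) -> (forall v, v \in s' -> D v) ->
  (forall a, D a -> exists2 b, D b & b != a) ->
  (forall a b, D a -> D b -> (a < b)%N -> restr a b s = restr a b s') -> s = s'.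
Proof.
move=> Ds Ds' D2 lt_eq.
have {lt_eq} : forall a b, D a -> D b -> a != b -> restr a b s = restr a b s'.
  move=> a b Da Db; rewrite neq_ltn => /orP[|ba]; first exact: lt_eq.
  have bna : b != a by rewrite neq_ltn ba.
  by rewrite ![restr a b _]restr_swap // lt_eq.
elim: s s' Ds Ds' => [|v s IH] [|v' s'] Ds Ds' eq_ab //.
- have [b Db bv] := D2 v' (Ds' _ (mem_head _ _)).
  have := eq_ab v' b (Ds' _ (mem_head _ _)) Db; rewrite eq_sym => /(_ bv).
  by rewrite /restr /= eqxx.
- have [b Db bv] := D2 v (Ds _ (mem_head _ _)).
  have := eq_ab v b (Ds _ (mem_head _ _)) Db; rewrite eq_sym => /(_ bv).
  by rewrite /restr /= eqxx.
have Dv := Ds _ (mem_head _ _); have Dv' := Ds' _ (mem_head _ _).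
have [vv|vv] := eqVneq v v'; last first.
  have := eq_ab v v' Dv Dv' vv; rewrite /restr /= !eqxx.
  by rewrite eq_sym (negPf vv).
subst v'; congr (_ :: _); apply: IH.
- by move=> x xs; apply: Ds; rewrite inE xs orbT.
- by move=> x xs; apply: Ds'; rewrite inE xs orbT.
- move=> a b Da Db ab; have := eq_ab a b Da Db ab; rewrite /restr /=.
  by case: (v == a); case: (v == b) => //= -[].
Qed.

Section Systems.
Variables (R : realType) (n : nat) (S : 'I_n -> R -> R) (sigma : seq crossing).

Lemma meet_at_sym (g h : R -> R) t : meet_at g h t <-> meet_at h g t.
Proof. by split=> -[t01 ght]; split. Qed.

Definition triples_have_signature := forall i j k : 'I_n, (i < j)%N -> (j < k)%N ->
  is_signature (S \o select i j k) sigma.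

Lemma regular_triples : regular S sigma -> triples_have_signature.
Proof.
move=> [_ _ _ sig] i j k ij jk; apply: sig => -[a ha] [b hb].
by case: a ha => [|[|[|a]]] // ha; case: b hb => [|[|[|b]]] // hb _;
  rewrite /select //=; apply: ltn_trans jk.
Qed.

Hypothesis S_sys : is_system S.

Lemma meet_inj i j k t : i != j -> i != k ->
  meet_at (S i) (S j) t -> meet_at (S i) (S k) t -> j = k.
Proof.
move=> ij ik mj mk; apply/eqP; apply: contraT => jk.
have ji : j != i by rewrite eq_sym.
by case: (system_no_triple S_sys (i := j) (j := i) (k := k) (t := t)) => //; apply/meet_at_sym.
Qed.

Lemma local_sequence_exists i : exists w, is_local_sequence S i w.
Proof.
have [j ji|ev [so un mem_ev]] := @finite_events R 'I_n nat (fun j => j != i)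
    (fun j => j.+1) (fun j t => meet_at (S i) (S j) t).
  by apply: (system_finite S_sys); rewrite eq_sym.
have sim t v v' : (t, v) \in ev -> (t, v') \in ev -> v = v'.
  move=> /mem_ev [j [-> ji mj]] /mem_ev [k [-> ki mk]].
  by rewrite (meet_inj _ _ mj mk) // eq_sym.
exists (map snd ev); have := records_pmap_weak (f := Some) so un.
have -> : pmap Some (map snd ev) = map snd ev by elim: (ev) => //= e s {1}->.
move=> /(_ (fun t a a' h h' _ _ => sim t a a' h h')).
apply: eq_records => t v; split.
  by move=> [a /mem_ev [j [-> ji mj]] [<-]]; exists j.
by move=> h; exists v => //; apply/mem_ev.
Qed.

Hypothesis S_sig : triples_have_signature.

Lemma restr_local_sequence i (w : seq nat) (j k : 'I_n) : is_local_sequence S i w ->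
  (j < k)%N -> j != i -> k != i -> restr j.+1 k.+1 w =
    pmap (if (i < j)%N then pair_xy else if (i < k)%N then pair_xz else pair_yz) sigma.
Proof.
move=> loc jk ji ki.
have := records_pmap (fun v => if v == j.+1 then Some false
  else if v == k.+1 then Some true else None) loc.
rewrite -/(restr _ _ _) => rec.
have from (a b c : 'I_n) (f : crossing -> option bool) : (a < b)%N -> (b < c)%N ->
    (forall t (d : bool), meet_at (S i) (S (if d then k else j)) t <->
       exists2 l, meet_at ((S \o select a b c) (crossing_pair l).1)
         ((S \o select a b c) (crossing_pair l).2) t & f l = Some d) ->
    restr j.+1 k.+1 w = pmap f sigma.
  move=> ab bc h; apply: (records_uniq _ rec (records_pmap f (S_sig ab bc))) => t d.
  rewrite -h; split.
    move=> [v [l [-> li m]]]; rewrite !eqSS.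
    case: eqVneq => [/ord_inj <- [<-] //|_].
    by case: eqVneq => [/ord_inj <- [<-] //|_].
  move=> m; exists (if d then k else j).+1.
    by exists (if d then k else j); split=> //; case: d m.
  case: d {m}; last by rewrite eqxx.
  by rewrite !eqSS eqxx gtn_eqF.
have [ij|] := ltnP i j.
  apply: (from i j k) => // t d; split.
    by move=> m; exists (if d then cr_y else cr_x); case: d m.
  by move=> [[] m // [dE]]; rewrite -dE.
rewrite leq_eqVlt => /orP[/eqP/ord_inj ji'|ji']; first by rewrite ji' eqxx in ji.
have [ik|] := ltnP i k.
  apply: (from j i k) => // t d; split.
    move=> m; exists (if d then cr_z else cr_x); case: d m => // m.
    exact/meet_at_sym.
  by move=> [[] m // [dE]]; rewrite -dE //; apply/meet_at_sym.
rewrite leq_eqVlt => /orP[/eqP/ord_inj ki'|ki']; first by rewrite ki' eqxx in ki.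
apply: (from j k i) => // t d; split.
  by move=> m; exists (if d then cr_z else cr_y); case: d m => // m; apply/meet_at_sym.
by move=> [[] m // [dE]]; rewrite -dE //; apply/meet_at_sym.
Qed.

Variable ws : seq block.
Hypothesis ws_pos : all (fun b => 0 < b.2)%N ws.
Hypothesis ws_code : block_code sigma ws.

Lemma tableau_blocks : is_tableau S (Tword (flatten (map letters_of ws)) n).
Proof.
move=> i; rewrite tnth_mktuple phi_local_word //.
have [w loc] := local_sequence_exists i.
suff <- : w = local_word i.+1 n ws by [].
have n3 := system_size S_sys.
apply: (@eq_from_restr (fun v => (0 < v <= n)%N && (v != i.+1))).
- case: loc => ev [_ h ->] v /mapP [[t v'] /h [j [-> ji _]] -> /=].
  by rewrite ltn_ord eqSS ji.
- move=> v /mem_local_word /orP[//|/andP[]].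
  by rewrite ltnNge ltn_ord.
(* One of the labels 1, 2, 3 differs from both [a] and [i.+1], and all three are at most [n]. *)
- move=> a _; suff [b [ba bi b0]] : exists b, [/\ b != a, b != i.+1 & (0 < b <= 3)%N].
    by exists b; rewrite // bi andbT; move: b0 n3; clear; lia.
  case: (boolP ((a != 1) && (i.+1 != 1)))%N => h1.
    by exists 1%N; split=> //; move: h1; clear; lia.
  case: (boolP ((a != 2) && (i.+1 != 2)))%N => h2.
    by exists 2%N; split=> //; move: h2; clear; lia.
  by exists 3%N; split=> //; move: h1 h2; clear; lia.
- move=> [|a] [|b] // /andP[an ai] /andP[bn bi]; rewrite ltnS => ab.
  have := @restr_local_sequence i w (Ordinal an) (Ordinal bn) loc ab ai bi.
  rewrite /= => ->; have [exy exz eyz] := ws_code.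
  case: ltnP => [ia|]; first by rewrite restr_local_high // ltnS ab.
  rewrite leq_eqVlt => /orP[/eqP ai'|ai']; first by rewrite ai' eqxx in ai.
  case: ltnP => [ib|]; first by rewrite restr_local_mid // ltnS ib.
  rewrite leq_eqVlt => /orP[/eqP bi'|bi']; first by rewrite bi' eqxx in bi.
  by rewrite restr_local_low // ltnS bi' ltn_ord.
Qed.
End Systems.

(** * Crossings in a system of four paths *)

Definition meet4 (R : realType) (S : 'I_4 -> R -> R) t e :=
  meet_at (S (inord (ends4 e).1)) (S (inord (ends4 e).2)) t.

Definition triple4 (f : pair4 -> option crossing) (a b c : nat) :=
  exists g : crossing -> pair4, forall d, (forall e, f e = Some d <-> e = g d) /\
    ends4 (g d) = (select a b c (crossing_pair d).1, select a b c (crossing_pair d).2).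

Lemma triples4 : [/\ triple4 in123 0 1 2, triple4 in124 0 1 3, triple4 in134 0 2 3
  & triple4 in234 1 2 3]%N.
Proof.
split; [exists (fun d => match d with cr_x => p12 | cr_y => p13 | cr_z => p23 end)
  |exists (fun d => match d with cr_x => p12 | cr_y => p14 | cr_z => p24 end)
  |exists (fun d => match d with cr_x => p13 | cr_y => p14 | cr_z => p34 end)
  |exists (fun d => match d with cr_x => p23 | cr_y => p24 | cr_z => p34 end)];
  by case; split=> // -[]; split.
Qed.

Lemma triple4_events (R : realType) (S : 'I_4 -> R -> R) f a b c t d : triple4 f a b c ->
  (exists2 e, meet4 S t e & f e = Some d) <->
  meet_at ((S \o select (inord a) (inord b) (inord c)) (crossing_pair d).1)
    ((S \o select (inord a) (inord b) (inord c)) (crossing_pair d).2) t.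
Proof.
move=> [g gP]; have [fg eg] := gP d; have [_ fgd] := fg (g d).
have sel i : select (inord a) (inord b) (inord c) i = inord (select a b c i) :> 'I_4.
  by rewrite /select; case: (val i) => [|[]].
rewrite /comp !sel; split=> [[e m /fg ee]|m].
  by move: m; rewrite ee /meet4 eg.
by exists (g d); rewrite ?fgd // /meet4 eg.
Qed.

Lemma finite_events4 (R : realType) (S : 'I_4 -> R -> R) : is_system S ->
  exists ev : seq (R * pair4), [/\ sorted (fun e1 e2 => e1.1 <= e2.1) ev, uniq ev
    & forall t e, (t, e) \in ev <-> meet4 S t e].
Proof.
move=> sys.
have [k _|ev [so un mem_ev]] := @finite_events R 'I_6 pair4 predT (fun k => pair4_of_nat k)
    (fun k t => meet4 S t (pair4_of_nat k)).
  apply: (system_finite sys); apply/eqP => /(congr1 val).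
  by case: (pair4_of_nat k); rewrite /= !inordK.
exists ev; split=> // t e.
split; first by move=> /mem_ev [k [-> _]].
move=> m; apply/mem_ev; have e6 : (nat_of_pair4 e < 6)%N by case: (e).
by exists (Ordinal e6); rewrite /= nat_of_pair4K.
Qed.

(** [W] lists all crossings, simultaneous ones in any order. Distinct crossings within a triple are
    never simultaneous, so each triple reads its signature off [W]. *)
Lemma regular_extension4 (R : realType) (S : 'I_4 -> R -> R) sigma :
  regular S sigma -> exists W, extension4 sigma W.
Proof.
move=> reg; have sig := regular_triples reg; have [_ sys _ _] := reg.
have [ev [so un mem_ev]] := finite_events4 sys.
exists (map snd ev).
have ext (a b c : nat) f : (a < b)%N -> (b < c < 4)%N -> triple4 f a b c ->
    pmap f (map snd ev) = sigma.
  move=> ab /andP[bc c4] fP.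
  have b4 := ltn_trans bc c4; have a4 := ltn_trans ab b4.
  have rec := sig (inord a) (inord b) (inord c).
  rewrite !inordK // in rec; have {}rec := rec ab bc.
  apply: (records_uniq _ (records_pmap_weak (f := f) so un _) rec).
    move=> t d; split.
      by move=> [e /mem_ev te fe]; apply/(triple4_events S t d fP); exists e.
    by move=> /(triple4_events S t d fP) [e te fe]; exists e => //; apply/mem_ev.
  move=> t e e' /mem_ev te /mem_ev te'.
  case fe: (f e) => [d|] // _; case fe': (f e') => [d'|] // _.
  have dd : d = d'.
    by apply: (records_inj rec (t := t)); apply/(triple4_events S t _ fP);
      [exists e|exists e'].
  by case: fP => g /(_ d) [fg _]; rewrite -dd in fe'; move/fg: fe => ->; move/fg: fe' => ->.
have [h1 h2 h3 h4] := triples4.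
by split; [apply: ext h1|apply: ext h2|apply: ext h3|apply: ext h4].
Qed.

(** * Parity of crossings *)

Section Parity.
Variable R : realType.
Implicit Types (g h : R -> R) (t : R).

Lemma constant_sign g h a b :
  {within `[0, 1], continuous g} -> {within `[0, 1], continuous h} ->
  0 <= a -> a <= b -> b <= 1 -> (forall t, a <= t <= b -> g t != h t) ->
  (g b < h b) = (g a < h a).
Proof.
move=> cg ch a0 ab b1 ne.
have sub : `[a, b] `<=` `[0 : R, 1].
  by move=> t /=; rewrite !in_itv /= => /andP[at_ tb]; rewrite (le_trans a0) ?(le_trans tb).
have cf : {within `[a, b], continuous (h - g)}.
  exact: continuous_subspaceW sub (within_continuousB ch cg).
have gl : g b != h b by apply: ne; rewrite ab lexx.
have ga : g a != h a by apply: ne; rewrite ab lexx.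
have fE t : (h - g) t = h t - g t by [].
case: (ltgtP (g a) (h a)) ga => // ha _; case: (ltgtP (g b) (h b)) gl => // hb _; exfalso.
- have [|c] := IVT ab cf (v := 0).
    by rewrite !fE ge_min le_max !subr_ge0 !subr_le0 (ltW hb) (ltW ha) ?orbT.
  rewrite in_itv /= => /ne + /eqP; rewrite fE subr_eq0 eq_sym => /negPf ->.
  by [].
- have [|c] := IVT ab cf (v := 0).
    by rewrite !fE ge_min le_max !subr_ge0 !subr_le0 (ltW hb) (ltW ha) ?orbT.
  rewrite in_itv /= => /ne + /eqP; rewrite fE subr_eq0 eq_sym => /negPf ->.
  by [].
Qed.

(** Induction on the meeting points: the order is constant up to the first one and reversed there,
    and the rest of the list is treated from a point [s2] just after it. *)
Lemma crossing_parity g h (L : seq R) a b :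
  {within `[0, 1], continuous g} -> {within `[0, 1], continuous h} ->
  0 <= a -> a < b -> b <= 1 -> g a != h a -> g b != h b ->
  sorted <%R L -> (forall t, t \in L -> a < t < b) ->
  (forall t, a < t < b -> g t = h t -> t \in L) ->
  (forall t, t \in L -> cross_at g h t) ->
  (g b < h b) = odd (size L) (+) (g a < h a).
Proof.
move=> cg ch; elim: L a => [|x L IH] a a0 ab b1 gha ghb so inab zero cr.
  rewrite /=; apply: constant_sign => //; first exact: ltW.
  move=> t /andP[]; rewrite le_eqVlt => /orP[/eqP <- //|at_].
  rewrite le_eqVlt => /orP[/eqP -> //|tb].
  apply/eqP => e; have := zero t; rewrite at_ tb => /(_ isT e).
  by rewrite in_nil.
have /andP[ax xb] := inab x (mem_head _ _).
have Lx : all (fun y => x < y) L.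
  by move: so; rewrite /= path_sortedE //; [case/andP|apply: lt_trans].
have near_left : \forall s \near x^'-, a < s < x.
  by near=> s; apply/andP; split; near: s; [apply: nbhs_left_gt|apply: nbhs_left_lt].
have near_all : \forall s \near x^'+, all (fun y => s < y) L.
  elim: L Lx {IH so inab zero cr} => [_|y L IH /= /andP[xy xL]]; first exact: nearW.
  near=> s; apply/andP; split; near: s; [exact: nbhs_right_lt|exact: IH].
have near_right : \forall s \near x^'+, [&& x < s, s < b & all (fun y => s < y) L].
  near=> s; apply/and3P; split; near: s;
    [exact: nbhs_right_gt|exact: nbhs_right_lt|exact: near_all].
suff [s1 [s2 [/andP[as1 s1x] /and3P[xs2 s2b s2L] [gh1 gh2 flip]]]] : exists s1 s2,
    [/\ a < s1 < x, [&& x < s2, s2 < b & all (fun y => s2 < y) L]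
      & [/\ g s1 != h s1, g s2 != h s2 & (g s2 < h s2) = ~~ (g s1 < h s1)]].
  have s20 : 0 <= s2 by rewrite (le_trans a0) // ltW // (lt_trans ax).
  rewrite (IH s2) //; first last.
  - by move=> t tL; apply: cr; rewrite inE tL orbT.
  - move=> t /andP[st tb] ght; have := zero t; rewrite tb (lt_trans _ st) ?(lt_trans ax) //.
    move=> /(_ isT ght); rewrite inE => /orP[/eqP tx|//].
    by move: st; rewrite tx ltNge (ltW xs2).
  - move=> t tL; rewrite (allP s2L) //=.
    have /andP[] : a < t < b by apply: inab; rewrite inE tL orbT.
    by [].
  - by move: so => /= /path_sorted.
  rewrite flip (@constant_sign g h a s1) ?(ltW as1) //=.
  - by rewrite addbN addNb.
  - by rewrite (le_trans (ltW s1x)) // (le_trans (ltW xb)).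
  move=> t /andP[]; rewrite le_eqVlt => /orP[/eqP <- //|at_].
  rewrite le_eqVlt => /orP[/eqP -> //|ts].
  have tx := lt_trans ts s1x.
  apply/eqP => e; have := zero t; rewrite at_ (lt_trans tx) // => /(_ isT e).
  rewrite inE (lt_eqF tx) /= => /(allP Lx).
  by rewrite ltNge (ltW tx).
have sgn (u v : R) : u < v -> [/\ u != v, v != u, (u < v) = true & (v < u) = false].
  by move=> uv; rewrite uv lt_eqF // gt_eqF // ltNge (ltW uv).
case: (cr x (mem_head _ _)) => -[l r].
- have [s1 [p1 q1]] := filter_ex (filterI near_left l).
  have [s2 [p2 q2]] := filter_ex (filterI near_right r).
  exists s1, s2; split=> //.
  by have [-> _ -> _] := sgn _ _ q1; have [_ -> _ ->] := sgn _ _ q2.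
- have [s1 [p1 q1]] := filter_ex (filterI near_left l).
  have [s2 [p2 q2]] := filter_ex (filterI near_right r).
  exists s1, s2; split=> //.
  by have [_ -> _ ->] := sgn _ _ q1; have [-> _ -> _] := sgn _ _ q2.
Unshelve. all: by end_near. Qed.

(** At a crossing the two paths have the same height, so the third one lies on the same side of
    both; each comparison is given by the parity of the earlier crossings of that pair. *)
Lemma signature_realizable sigma : signature R sigma -> realizable sigma.
Proof.
move=> [f [sys sig]] u c v e; have [ev [so mem_ev evs]] := sig.
move: evs; rewrite e => /esym; set evu := take (size u) ev.
have [evv evE] : exists evv, ev = evu ++ evv.
  by exists (drop (size u) ev); rewrite cat_take_drop.
move=> evs; have [t [evv' evvE]] : exists t evv', evv = (t, c) :: evv'.
  have /(congr1 (drop (size u))) := evs; rewrite -map_drop drop_size_cat // evE.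
  have -> : drop (size u) (evu ++ evv) = evv.
    apply: drop_size_cat; rewrite size_takel // -(size_map snd) evs size_cat leq_addr //.
  by case: evv {evE} => [|[t c'] evv] //= [-> _]; exists t, evv.
have uE : map snd evu = u.
  have /(congr1 (take (size u))) := evs; rewrite take_size_cat // -map_take //.
subst evv; have pw : pairwise (fun e1 e2 : R * crossing => e1.1 < e2.1) ev.
  by rewrite -sorted_pairwise // => e1 e2 e3; apply: lt_trans.
have before_t x d : (x, d) \in ev -> ((x, d) \in evu) = (x < t).
  move: pw; rewrite evE pairwise_cat => /and3P[/allrelP rel _ /= /andP[/allP pt _]].
  rewrite mem_cat => /orP[xu|]; first by rewrite xu (rel _ _ xu (mem_head _ _)).
  move=> xv; apply/idP/idP => [xu|].
    exact: (rel _ _ xu (mem_head _ _)).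
  move: xv; rewrite inE => /orP[/eqP[-> _]|/pt /= tx]; first by rewrite ltxx.
  by rewrite ltNge (ltW tx).
have mt : meet_at (f (crossing_pair c).1) (f (crossing_pair c).2) t.
  by apply/mem_ev; rewrite evE mem_cat mem_head orbT.
have [t01 fct] := mt.
have t1 : t <= 1 by move: t01; rewrite /= in_itv => /andP[].
have pair_lt d : ((crossing_pair d).1 < (crossing_pair d).2)%N by case: d.
have pair_neq d : (crossing_pair d).1 != (crossing_pair d).2 by case: d.
have left d := system_left sys (pair_lt d).
have t0 : 0 < t.
  have : 0 <= t by move: t01; rewrite /= in_itv => /andP[].
  rewrite le_eqVlt => /orP[/eqP t0|//].
  by exfalso; move: fct (left c); rewrite -t0 => ->; rewrite ltxx.
have ne d : d != c -> f (crossing_pair d).1 t != f (crossing_pair d).2 t.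
  move=> dc; apply/eqP => e'; move: dc.
  by rewrite (records_inj sig (t := t) (a := d) (a' := c)) ?eqxx.
have par d : d != c ->
    (f (crossing_pair d).1 t < f (crossing_pair d).2 t) = ~~ odd (count_mem d u).
  move=> dc; have meetd x : 0 < x < t -> f (crossing_pair d).1 x = f (crossing_pair d).2 x ->
      (x, d) \in ev.
    move=> /andP[x0 xt] e'; apply/mem_ev; split=> //.
    by rewrite /= in_itv /= (ltW x0) (le_trans (ltW xt)).
  set L := [seq e.1 | e <- evu & e.2 == d].
  have LP x : x \in L <-> (x, d) \in ev /\ x < t.
    split.
      move=> /mapP[[y d'] + ->]; rewrite mem_filter => /andP[/= /eqP -> yu].
      have yev : (y, d) \in ev by rewrite evE mem_cat yu.
      by rewrite yev -(before_t _ _ yev).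
    move=> [xev xt]; apply/mapP; exists (x, d) => //.
    by rewrite mem_filter eqxx before_t.
  rewrite (@crossing_parity _ _ L 0 t) //; first last.
  - move=> x /LP [/mem_ev m _]; exact: (system_cross sys) m.
  - by move=> x xt e'; apply/LP; split; [apply: meetd|case/andP: xt].
  - move=> x /LP [/mem_ev [x01 m] ->]; rewrite andbT.
    have : 0 <= x by move: x01; rewrite /= in_itv => /andP[].
    rewrite le_eqVlt => /orP[/eqP x0|//].
    by exfalso; move: m (left d); rewrite -x0 => ->; rewrite ltxx.
  - rewrite sorted_map; apply: sorted_filter; first by move=> e1 e2 e3; apply: lt_trans.
    by move: so; rewrite evE => /cat_sorted2 [].
  - exact: ne.
  - by rewrite lt_eqF // left.
  - by apply: (system_continuous sys).
  - by apply: (system_continuous sys).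
  by rewrite left addbT size_map size_filter -uE count_map.
have := (par cr_x, par cr_y, par cr_z, ne cr_x).
(* For y alone, the third path is compared once from below and once from above, whence the
   negation. *)
case: c {e evs evE before_t mt t01 left par evu uE pw ne} fct => /= fct [[[px py] pz] nx].
- by apply: negb_inj; rewrite -py // -pz // fct.
- have := px isT; have := pz isT; rewrite -fct => <- lt; apply: negb_inj.
  by rewrite -lt ltNge le_eqVlt eq_sym (negPf (nx isT)).
- by apply: negb_inj; rewrite -px // -py // fct.
Qed.
End Parity.

(** * A piecewise linear system *)

Section Interpolation.
Variable R : realType.

(** The projection onto [0, 1], written with norms so that continuity is immediate. *)
Definition clamp (u : R) : R := (`|u| - `|u - 1| + 1) / 2.

Lemma clamp_low u : u <= 0 -> clamp u = 0.
Proof. by move=> u0; rewrite /clamp !ler0_norm ?subr_le0 //; lra. Qed.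

Lemma clamp_high u : 1 <= u -> clamp u = 1.
Proof. by move=> u1; rewrite /clamp !ger0_norm ?subr_ge0 //; lra. Qed.

Lemma clamp_mid u : 0 <= u <= 1 -> clamp u = u.
Proof.
move=> /andP[u0 u1].
by rewrite /clamp ger0_norm // ler0_norm ?subr_le0 //; lra.
Qed.

Lemma clamp_continuous : continuous clamp.
Proof.
move=> u; apply: cvgMl; apply: cvgD; last exact: cvg_cst.
apply: cvgB; first by apply: cvg_norm; apply: cvg_id.
by apply: cvg_norm; apply: cvgB; [apply: cvg_id|apply: cvg_cst].
Qed.

(** Piecewise linear with value [P k] at each k <= n and constant outside [0, n]: on [k, k + 1] only
    the k-th term varies. *)
Definition interpolation (P : nat -> R) (n : nat) (u : R) : R :=
  P 0%N + \sum_(0 <= k < n) (P k.+1 - P k) * clamp (u - k%:R).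

Lemma interpolationS P n u : interpolation P n.+1 u =
  interpolation P n u + (P n.+1 - P n) * clamp (u - n%:R).
Proof. by rewrite /interpolation big_nat_recr //= addrA. Qed.

Lemma interpolation_continuous P n : continuous (interpolation P n).
Proof.
elim: n => [|n IH] u.
  have -> : interpolation P 0 = fun=> P 0%N.
    by apply/funext => x; rewrite /interpolation big_geq // addr0.
  exact: cvg_cst.
have -> : interpolation P n.+1 =
    fun u => interpolation P n u + (P n.+1 - P n) * clamp (u - n%:R).
  by apply/funext => x; rewrite interpolationS.
apply: cvgD; first exact: IH.
apply: cvgMr; apply: (@cvg_comp _ _ _ (fun x => x - n%:R) clamp _ (nbhs (u - n%:R))).
  by apply: cvgB; [apply: cvg_id|apply: cvg_cst].
exact: clamp_continuous.
Qed.

Lemma interpolation_high P n u : n%:R <= u -> interpolation P n u = P n.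
Proof.
elim: n => [|n IH] nu; first by rewrite /interpolation big_geq // addr0.
rewrite -natr1 in nu; rewrite interpolationS IH ?clamp_high; lra.
Qed.

Lemma interpolation_mid P n l u : (l < n)%N -> l%:R <= u <= l%:R + 1 ->
  interpolation P n u = P l + (P l.+1 - P l) * (u - l%:R).
Proof.
elim: n => // n IH; rewrite ltnS leq_eqVlt => /orP[/eqP <-|ln] /andP[lu ul].
  by rewrite interpolationS interpolation_high // clamp_mid //; lra.
have : (l.+1%:R <= n%:R :> R) by rewrite ler_nat.
rewrite -natr1 => ln'.
by rewrite interpolationS IH ?ln ?lu // clamp_low ?mulr0 ?addr0 //; lra.
Qed.

Lemma unit_segment n (u : R) : (0 < n)%N -> 0 <= u <= n%:R ->
  exists2 l, (l < n)%N & l%:R <= u <= l%:R + 1.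
Proof.
elim: n => // n IH _ /andP[u0]; rewrite -natr1 => un.
have [nu|un'] := lerP n%:R u; first by exists n => //; rewrite nu.
case: n IH un un' => [|n] IH un un'; first by lra.
have [|l ln lu] := IH isT; first by rewrite u0 ltW.
by exists l => //; apply: ltnW.
Qed.
End Interpolation.

Section Construction.
Variables (R : realType) (sigma : seq crossing) (W : seq pair4).
Hypothesis W_ext : extension4 sigma W.
Hypothesis sigma_real : realizable sigma.
Hypothesis W_gt0 : (0 < size W)%N.

Let L : R := (size W)%:R.
Let L_gt0 : 0 < L. Proof. by rewrite ltr0n. Qed.
Let P (i : 'I_4) (l : nat) : R := (place (take l W) i)%:R.

(** Time is stretched to [0, L]; path [i] has height [P i l] at time l, and the crossing
    [nth p12 W l] is carried out on [l, l + 1]. *)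
Definition system4 (i : 'I_4) (t : R) : R := interpolation (P i) (size W) (L * t).

Let system4E i l t : (l < size W)%N -> l%:R <= L * t <= l%:R + 1 ->
  system4 i t = P i l + (P i l.+1 - P i l) * (L * t - l%:R).
Proof. exact: interpolation_mid. Qed.

Let P_lt e (i j : 'I_4) l : ends4 e = (val i, val j) ->
  (P i l < P j l) = ~~ odd (count_mem e (take l W)).
Proof.
move=> ee; rewrite ltr_nat -(place_lt _ W_ext sigma_real (esym (cat_take_drop l W))).
by rewrite ee.
Qed.

Let P_neq (i j : 'I_4) l : i != j -> P i l != P j l.
Proof. by move=> ij; rewrite eqr_nat; apply: contra ij => /eqP /place_inj /ord_inj ->. Qed.

Let P_swap e (i j : 'I_4) l : (l < size W)%N -> nth p12 W l = e ->
  ends4 e = (val i, val j) -> P i l.+1 = P j l /\ P j l.+1 = P i l.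
Proof.
move=> lW We ee; rewrite /P (take_nth p12) // We !place_rcons /swap4 ee /= !eqxx.
by case: eqP => [->|].
Qed.

(** A pair that does not cross on this segment has the same order at both ends, hence in between, as
    heights are affine there. *)
Let order_kept e (i j : 'I_4) l t : (l < size W)%N -> l%:R <= L * t <= l%:R + 1 ->
  ends4 e = (val i, val j) -> nth p12 W l != e -> system4 i t != system4 j t.
Proof.
move=> lW lt ee ne; rewrite !(system4E _ lW lt).
have ij : i != j by apply/eqP => ij; move: ee; rewrite ij; case: (e) => -[<-].
have := P_neq l ij; have := P_neq l.+1 ij.
(* The vanishing xor bit turns the parity at [l] into the parity at [l.+1]. *)
have := P_lt l ee; rewrite -[RHS]addbF.
have <- : (nth p12 W l == e) = false by apply: negbTE.
have -> : ~~ odd (count_mem e (take l W)) (+) (nth p12 W l == e) =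
    ~~ odd (count_mem e (take l.+1 W)).
  by rewrite (take_nth p12) // -cats1 count_cat oddD /= addn0 oddb addNb.
rewrite -(P_lt l.+1 ee).
set s := L * t - l%:R; have {lt} : 0 <= s <= 1 by rewrite /s; move: lt => /andP[? ?]; lra.
move: (P i l) (P j l) (P i l.+1) (P j l.+1) => a b a' b' /andP[s0 s1] ab ne1 ne2.
have pos x x' : 0 < x -> 0 < x' -> 0 < x * (1 - s) + x' * s.
  move=> x0 x'0; have [->|s0'] := eqVneq s 0; first by rewrite subr0 mulr1 mulr0 addr0.
  rewrite ltr_wpDl // ?mulr_gt0 // ?lt_neqAle ?s0 1?eq_sym ?s0' //.
  by rewrite mulr_ge0 ?subr_ge0 // ltW.
case: (ltgtP a b) ab ne2 => // h ab _; case: (ltgtP a' b') ab ne1 => // h' _ _.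
  rewrite lt_eqF // -subr_gt0.
  have := pos (b - a) (b' - a'); rewrite !subr_gt0 => /(_ h h'); lra.
rewrite gt_eqF // -subr_gt0.
have := pos (a - b) (a' - b'); rewrite !subr_gt0 => /(_ h h'); lra.
Qed.

(** The midpoint of the l-th segment, where two paths that exchange their heights linearly meet. *)
Definition crossing_time (l : nat) : R := (l%:R + 2^-1) / L.

Let crossing_timeE l : L * crossing_time l = l%:R + 2^-1.
Proof. by rewrite /crossing_time mulrC divfK // gt_eqF. Qed.

Let crossing_time_lt l l' : (crossing_time l < crossing_time l') = (l < l')%N.
Proof. by rewrite ltr_pM2r ?invr_gt0 // ltrD2r ltr_nat. Qed.

Let crossing_time_in l : (l < size W)%N -> `[0, 1]%classic (crossing_time l).
Proof.
move=> lW; rewrite /= in_itv /= /crossing_time; apply/andP; split.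
  by rewrite divr_ge0 // ?ltW // ltr_wpDl.
rewrite ler_pdivrMr // mul1r.
have : (l.+1%:R <= L) by rewrite ler_nat.
rewrite -natr1; lra.
Qed.

Lemma meet4E e t : meet4 system4 t e <->
  exists l, [/\ (l < size W)%N, nth p12 W l = e & t = crossing_time l].
Proof.
have [i [j ee]] : exists i j : 'I_4, ends4 e = (val i, val j).
  by exists (inord (ends4 e).1), (inord (ends4 e).2); case: (e); rewrite /= !inordK.
have ij : i != j by apply/eqP => ij; move: ee; rewrite ij; case: (e) => -[<-].
rewrite /meet4 ee /= !inord_val; split.
  move=> [t01 ij_t]; have [|l lW lt] := @unit_segment R (size W) (L * t) W_gt0.
    move: t01; rewrite /= in_itv /= => /andP[t0 t1].
    by rewrite mulr_ge0 ?(ltW L_gt0) //= -[leRHS]mulr1 ler_pM2l.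
  have [We|We] := eqVneq (nth p12 W l) e; last first.
    by have := order_kept lW lt ee We; rewrite ij_t eqxx.
  exists l; split=> //; apply: (mulfI (lt0r_neq0 L_gt0)); rewrite crossing_timeE.
  move: ij_t; rewrite !(system4E _ lW lt).
  have [-> ->] := P_swap lW We ee => e1.
  have : (P i l - P j l) * (1 - 2 * (L * t - l%:R)) = 0 by move: e1; lra.
  move/eqP; rewrite mulf_eq0 subr_eq0 (negPf (P_neq l ij)) /= => /eqP; lra.
move=> [l [lW We ->]]; split; first exact: crossing_time_in.
have lt : l%:R <= L * crossing_time l <= l%:R + 1 by rewrite crossing_timeE; lra.
have [e1 e2] := P_swap lW We ee.
by rewrite !(system4E _ lW lt) e1 e2 crossing_timeE; lra.
Qed.

Let ends_of (i j : 'I_4) : (i < j)%N -> exists e, ends4 e = (val i, val j).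
Proof.
case: i j => [[|[|[|[|i]]]] hi] [[|[|[|[|j]]]] hj] //= _;
  by [exists p12|exists p13|exists p14|exists p23|exists p24|exists p34].
Qed.

Let meet_pair e (i j : 'I_4) t : ends4 e = (val i, val j) ->
  meet_at (system4 i) (system4 j) t <-> meet4 system4 t e.
Proof. by move=> ee; rewrite /meet4 ee /= !inord_val. Qed.

Let crossC (g h : R -> R) t : cross_at g h t -> cross_at h g t.
Proof. by case; [right|left]. Qed.

Let cross_pair e (i j : 'I_4) t : ends4 e = (val i, val j) ->
  meet_at (system4 i) (system4 j) t -> cross_at (system4 i) (system4 j) t.
Proof.
move=> ee /(meet_pair _ ee) /meet4E [l [lW We ->]].
have ij : i != j by apply/eqP => ij; move: ee; rewrite ij; case: (e) => -[<-].
have [e1 e2] := P_swap lW We ee.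
have before_cross : \forall s \near (crossing_time l)^'-,
    l%:R <= L * s <= l%:R + 1 /\ L * s < l%:R + 2^-1.
  near=> s.
  have s1 : l%:R / L < s.
    near: s; apply: nbhs_left_gt; rewrite /crossing_time ltr_pM2r ?invr_gt0 //; lra.
  have s2 : s < crossing_time l by near: s; exact: nbhs_left_lt.
  rewrite ltr_pdivrMr // mulrC in s1.
  rewrite /crossing_time ltr_pdivlMr // mulrC in s2.
  by split=> //; apply/andP; split; lra.
have after_cross : \forall s \near (crossing_time l)^'+,
    l%:R <= L * s <= l%:R + 1 /\ l%:R + 2^-1 < L * s.
  near=> s.
  have s1 : s < (l%:R + 1) / L.
    near: s; apply: nbhs_right_lt; rewrite /crossing_time ltr_pM2r ?invr_gt0 //; lra.
  have s2 : crossing_time l < s by near: s; exact: nbhs_right_gt.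
  rewrite ltr_pdivlMr // mulrC in s1.
  rewrite /crossing_time ltr_pdivrMr // mulrC in s2.
  by split=> //; apply/andP; split; lra.
(* The gap is affine with non-zero slope and vanishes at the midpoint, so its sign changes there. *)
have gap s : l%:R <= L * s <= l%:R + 1 ->
    system4 j s - system4 i s = 2 * ((P j l - P i l) * (l%:R + 2^-1 - L * s)).
  by move=> ls; rewrite !(system4E _ lW ls) e1 e2; lra.
have := P_neq l ij; rewrite neq_lt => /orP[lt|lt]; [left|right]; split; near=> s.
- have [ls h] : l%:R <= L * s <= l%:R + 1 /\ L * s < l%:R + 2^-1 by near: s.
  by rewrite -subr_gt0 gap // mulr_gt0 // mulr_gt0 // subr_gt0.
- have [ls h] : l%:R <= L * s <= l%:R + 1 /\ l%:R + 2^-1 < L * s by near: s.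
  by rewrite -subr_lt0 gap // pmulr_rlt0 // pmulr_rlt0 ?subr_gt0 // subr_lt0.
- have [ls h] : l%:R <= L * s <= l%:R + 1 /\ L * s < l%:R + 2^-1 by near: s.
  by rewrite -subr_lt0 gap // pmulr_rlt0 // nmulr_rlt0 ?subr_lt0 // subr_gt0.
- have [ls h] : l%:R <= L * s <= l%:R + 1 /\ l%:R + 2^-1 < L * s by near: s.
  by rewrite -subr_gt0 gap // mulr_gt0 // nmulr_rgt0 ?subr_lt0.
Unshelve. all: by end_near. Qed.

Let pair_of (i j : 'I_4) : i != j -> exists e,
  ends4 e = (val i, val j) \/ ends4 e = (val j, val i).
Proof.
by rewrite neq_ltn => /orP[] /ends_of [e ee]; exists e; [left|right].
Qed.

Let meet_time (i j : 'I_4) t : i != j -> meet_at (system4 i) (system4 j) t ->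
  exists l, [/\ (l < size W)%N, t = crossing_time l
    & ends4 (nth p12 W l) = (val i, val j) \/ ends4 (nth p12 W l) = (val j, val i)].
Proof.
move=> /pair_of [e [ee|ee]].
  by move=> /(meet_pair _ ee) /meet4E [l [lW We ->]]; exists l; rewrite We; split=> //; left.
by move=> /meet_at_sym /(meet_pair _ ee) /meet4E [l [lW We ->]]; exists l;
  rewrite We; split=> //; right.
Qed.

Lemma is_system4 : is_system system4.
Proof.
split=> //.
- move=> i; apply: continuous_subspaceT => t.
  apply: (@cvg_comp _ _ _ (fun x => L * x) (interpolation (P i) (size W)) _ (nbhs (L * t))).
    by apply: cvgMr; apply: cvg_id.
  exact: interpolation_continuous.
- move=> i j ij; have start k : system4 k 0 = P k 0.
    have := @system4E k 0%N 0 W_gt0; rewrite mulr0 mulr0n subr0 mulr0 addr0; apply.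
    by rewrite add0r lexx ler01.
  by rewrite !start /P !take0 ltr_nat.
- move=> i j ij; rewrite /system4 mulr1 !interpolation_high //.
  exact: P_neq.
- move=> i j ij.
  apply: (@sub_finite_set _ _ [set` [seq crossing_time l | l <- iota 0 (size W)]]).
    move=> t /(meet_time ij) [l [lW -> _]] /=.
    by apply: map_f; rewrite mem_iota.
  exact: finite_seq.
- move=> i j t /pair_of [e [ee|ee]] m; first exact: cross_pair ee m.
  by apply: crossC; apply: cross_pair ee _; apply/meet_at_sym.
- move=> i j k t ij jk ik /(meet_time ij) [l [_ -> h]] /(meet_time jk) [l' [_ tt h']].
  (* Distinct indices have distinct crossing times, so a triple point would make a single crossing
     exchange two different pairs. *)
  have ll : l = l'.
    by case: (ltngtP l l') => //; rewrite -crossing_time_lt tt ltxx.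
  rewrite -ll in h'; case: h h' => -> [] /=.
  + by move=> [e _]; move: ij; rewrite (ord_inj e) eqxx.
  + by move=> [e]; move: ik; rewrite (ord_inj e) eqxx.
  + by move=> [e]; move: ik; rewrite (ord_inj e) eqxx.
  + by move=> [e _]; move: jk; rewrite (ord_inj e) eqxx.
Qed.

Lemma records_system4 : records (meet4 system4) W.
Proof.
exists [seq (crossing_time l, nth p12 W l) | l <- iota 0 (size W)]; split.
- rewrite sorted_map; apply: sub_sorted (iota_ltn_sorted 0 (size W)) => l l' /=.
  by rewrite crossing_time_lt.
- move=> t e; split.
    move=> /mapP[l + [-> ->]]; rewrite mem_iota add0n => /andP[_ lW].
    by apply/meet4E; exists l.
  move=> /meet4E [l [lW <- ->]]; apply/mapP; exists l => //.
  by rewrite mem_iota.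
- by rewrite -map_comp (map_nth_iota0 _ (leqnn _)) take_size.
Qed.

Lemma regular_system4 : regular system4 sigma.
Proof.
split=> //; first exact: is_system4.
  case: W_ext W_gt0 => e123 e124 e134 e234 _; apply/eqP => s0.
  move: W_gt0 e123 e124 e134 e234; rewrite s0.
  by case: (W) => // -[].
move=> h mono.
have sig f a b c : triple4 f a b c -> pmap f W = sigma ->
    h path1 = inord a -> h path2 = inord b -> h path3 = inord c ->
    is_signature (system4 \o h) sigma.
  move=> fP fW h1 h2 h3; have := records_pmap f records_system4; rewrite fW.
  apply: eq_records => t d; rewrite (triple4_events system4 t d fP).
  suff hE k : h k = select (inord a) (inord b) (inord c) k by rewrite /comp !hE.
  case: k => [[|[|[|k]]] hk] //; [rewrite -h1|rewrite -h2|rewrite -h3];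
    by rewrite /select /=; congr h; apply: val_inj.
have [t123 t124 t134 t234] := triples4.
have [e123 e124 e134 e234] := W_ext.
have lt12 := mono path1 path2 isT; have lt23 := mono path2 path3 isT.
have val_eq (k : 'I_4) a : nat_of_ord k = a -> k = inord a.
  by move=> <-; rewrite inord_val.
move: (val_eq (h path1)) (val_eq (h path2)) (val_eq (h path3)) lt12 lt23 (ltn_ord (h path3)).
move: (nat_of_ord (h path1)) (nat_of_ord (h path2)) (nat_of_ord (h path3)).
(* Only the four increasing triples of indices remain. *)
move=> [|[|[|[|i]]]] [|[|[|[|j]]]] [|[|[|[|k]]]] //;
  move=> h1 h2 h3 _ _ _; have {}h1 := h1 _ erefl; have {}h2 := h2 _ erefl;
  have {}h3 := h3 _ erefl.
- exact: sig t123 e123 h1 h2 h3.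
- exact: sig t124 e124 h1 h2 h3.
- exact: sig t134 e134 h1 h2 h3.
- exact: sig t234 e234 h1 h2 h3.
Qed.
End Construction.

(** * The equivalence and the tableaux *)

Lemma triples3 (R : realType) (f : 'I_3 -> R -> R) sigma :
  is_signature f sigma -> triples_have_signature f sigma.
Proof.
move=> sig i j k ij jk; apply: eq_records sig => t d.
have sel l : select i j k l = l.
  apply: val_inj; move: ij jk (ltn_ord i) (ltn_ord j) (ltn_ord k); rewrite /select.
  by case: l => [[|[|[|l]]] hl] //=; lia.
by rewrite /comp !sel.
Qed.

Lemma tableau_block_code (R : realType) (f : 'I_3 -> R -> R) sigma ws :
  is_signature f sigma -> all (fun b => 0 < b.2)%N ws ->
  is_tableau f (Tword (flatten (map letters_of ws)) 3) -> block_code sigma ws.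
Proof.
move=> sig pos tab; have trip := triples3 sig.
have word i : is_local_sequence f i (local_word i.+1 3 ws).
  by have := tab i; rewrite tnth_mktuple phi_local_word.
split.
- rewrite -(@restr_local_high 2 3 1 3) //.
  by rewrite -(restr_local_sequence (j := path2) (k := path3) trip (word path1)).
- rewrite -(@restr_local_mid 1 3 2 3) //.
  by rewrite -(restr_local_sequence (j := path1) (k := path3) trip (word path2)).
- rewrite -(@restr_local_low 1 2 3 3) //.
  by rewrite -(restr_local_sequence (j := path1) (k := path2) trip (word path3)).
Qed.

Lemma condition2E sigma :
  (exists (alpha beta gamma : seq crossing) (p q : nat),
      [/\ sigma = alpha ++ beta ++ gamma \/ sigma = gamma ++ beta ++ alpha,
          (num_X alpha, num_Y alpha, num_Z alpha) = (p, p, 0%N),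
          (num_X beta, num_Y beta, num_Z beta) = (q, 0%N, p),
          (num_X gamma, num_Y gamma, num_Z gamma) = (0%N, q, q)
        & ~ (p = 0%N /\ q = 0%N)]) <->
  forward_split sigma \/ forward_split (map flip_crossing sigma).
Proof.
split.
  move=> [a [b [c [p [q [[e|e] h1 h2 h3 h4]]]]]]; [left|right].
    by exists a, b, c, p, q.
  by apply/forward_split_flip; exists a, b, c, p, q.
case=> [[a [b [c [p [q [e h1 h2 h3 h4]]]]]]|].
  by exists a, b, c, p, q; split=> //; left.
move=> /forward_split_flip [a [b [c [p [q [e h1 h2 h3 h4]]]]]].
by exists a, b, c, p, q; split=> //; right.
Qed.

(** The code makes x, y, z equally frequent in [sigma]; both sums equal this common number, which is
    positive. *)
Lemma block_code_W_abcd sigma ws : sigma != [::] -> block_code sigma ws ->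
  all (fun b => 0 < b.2)%N ws -> W_abcd (flatten (map letters_of ws)).
Proof.
move=> s0 code pos.
have [xs zs] : count_mem cr_x sigma = cd_sum ws /\ count_mem cr_x sigma = ab_sum ws.
  case: code => exy exz _; split.
    by rewrite -(@count_pmap _ _ pair_xy cr_x false) ?exy ?count_xy_word //; case.
  by rewrite -(@count_pmap _ _ pair_xz cr_x false) ?exz ?count_xz_word //; case.
have [ys _] : count_mem cr_y sigma = cd_sum ws /\ True.
  case: code => exy _ _; split=> //.
  by rewrite -(@count_pmap _ _ pair_xy cr_y true) ?exy ?count_xy_word //; case.
have zs' : count_mem cr_z sigma = cd_sum ws.
  case: code => _ exz _.
  by rewrite -(@count_pmap _ _ pair_xz cr_z true) ?exz ?count_xz_word //; case.
have size_gt0 : (0 < cd_sum ws)%N.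
  by case: sigma s0 xs ys zs' {code zs} => // -[] w _ /=; lia.
by apply: blocks_W_abcd; rewrite // -zs xs.
Qed.

Theorem proposition5p4 (R : realType) (sigma : seq crossing)
    (sigma_signature : signature R sigma)
    (sigma_irreducible : irreducible sigma) :
  let cond1 (omega : seq letter) :=
    W_abcd omega /\
    exists f : 'I_3 -> R -> R,
      [/\ is_system f, is_signature f sigma & is_tableau f (Tword omega 3)] in
  let cond2 :=
    exists (alpha beta gamma : seq crossing) (p q : nat),
      [/\ sigma = alpha ++ beta ++ gamma \/ sigma = gamma ++ beta ++ alpha,
          (num_X alpha, num_Y alpha, num_Z alpha) = (p, p, 0%N),
          (num_X beta, num_Y beta, num_Z beta) = (q, 0%N, p),
          (num_X gamma, num_Y gamma, num_Z gamma) = (0%N, q, q)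
        & ~ (p = 0%N /\ q = 0%N)] in
  (extendable R sigma <-> (exists omega, cond1 omega) /\ cond2) /\
  (forall (n : nat) (S : 'I_n -> R -> R), regular S sigma ->
     forall omega, cond1 omega -> is_tableau S (Tword omega n)).
Proof.
move=> cond1 cond2.
have cond1_blocks omega : cond1 omega -> exists ws,
    [/\ omega = flatten (map letters_of ws), all (fun b => 0 < b.2)%N ws
      & block_code sigma ws].
  move=> [/W_abcd_blocks [ws [-> pos]] [f [_ sig tab]]].
  by exists ws; split=> //; apply: tableau_block_code sig pos tab.
split; last first.
  move=> n S reg omega /cond1_blocks [ws [-> pos code]].
  case: (reg) => _ sys _ _.
  exact: (@tableau_blocks R n S sigma sys (regular_triples reg) ws pos code).
have s0 : sigma != [::] by case: sigma_irreducible.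
split.
  move=> [S reg]; have [W ext] := regular_extension4 reg.
  have [ws [pos code]] := extension4_blocks ext.
  split; last by apply/condition2E; apply: extension4_forward ext _ pos code.
  exists (flatten (map letters_of ws)); split; first exact: block_code_W_abcd s0 code pos.
  (* Any system of size 3 with signature [sigma] serves, because its tableau is determined by
     [sigma]. *)
  have [f [sys sig]] := sigma_signature; exists f; split=> //.
  exact: (@tableau_blocks R 3 f sigma sys (triples3 sig) ws pos code).
move=> [[omega /cond1_blocks [ws [_ pos code]]] /condition2E fwd].
have [W ext] := condition2_extension4 pos code fwd.
have W_gt0 : (0 < size W)%N.
  by case: ext s0 => <- _ _ _; case: (W).
exists (system4 (R := R) W).
exact: regular_system4 ext (signature_realizable sigma_signature) W_gt0.
Qed.
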